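(* Let $K$ be a field, let $G$ be a graph on $[n]$, and let $J_G\subset K[x_1,\dots,x_n,y_1,\dots,y_n]$ be its binomial edge ideal. (a) If $G$ is traceable, then $J_G$ is of König type. In particular, if $G$ is a closed graph, then $J_G$ is of König type. (b) If $J_G$ is unmixed and of König type, then $G$ is traceable.
   Context: Graphs are finite and simple. The binomial edge ideal of $G$ is $J_G=(x_iy_j-x_jy_i : i<j,\ \{i,j\}\in E(G))$. A connected graph is traceable if it has a spanning path, i.e. a path subgraph containing all its vertices; in general a graph is called traceable if each of its connected components is traceable. A graph $G$ on $[n]$ is closed if its vertices can be labelled by $1,\dots,n$ such that for all edges $\{i,j\}\neq\{k,l\}$ with $i<j$ and $k<l$: if $i=k$ then $\{j,l\}\in E(G)$, and if $j=l$ then $\{i,k\}\in E(G)$. An ideal is unmixed if all its associated primes have the same height. A graded ideal $I$ of height $h$ in a polynomial ring over a field is of König type if there exist a sequence $f_1,\dots,f_h$ of homogeneous polynomials forming part of a minimal system of generators of $I$ and a monomial order $<$ such that $\operatorname{in}_<(f_1),\dots,\operatorname{in}_<(f_h)$ is a regular sequence. *)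

(* Defs.v *)
From HB Require Import structures.
From mathcomp Require Import all_boot all_order all_fingroup all_algebra.
From mathcomp Require Export mpoly.

Set Implicit Arguments.
Unset Strict Implicit.
Unset Printing Implicit Defensive.

Import GRing.Theory.
Local Open Scope ring_scope.

(* Ideals are Prop-valued predicates, since membership in an arbitrary ideal
   is not decidable. *)

Section Ideals.

Variable R : comNzRingType.

Definition subideal (I J : R -> Prop) : Prop := forall f, I f -> J f.

Definition eqideal (I J : R -> Prop) : Prop := forall f, I f <-> J f.

Definition is_ideal (I : R -> Prop) : Prop :=
  [/\ I 0,
      forall f g, I f -> I g -> I (f + g)
    & forall a f, I f -> I (a * f)].

Definition is_prime_ideal (P : R -> Prop) : Prop :=
  [/\ is_ideal P, ~ P 1 & forall f g, P (f * g) -> P f \/ P g].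

Definition ideal_gen (S : R -> Prop) (f : R) : Prop :=
  exists (m : nat) (a g : 'I_m -> R),
    (forall i, S (g i)) /\ f = \sum_(i < m) a i * g i.

Definition ideal_of_seq (s : seq R) : R -> Prop :=
  ideal_gen (fun g => g \in s).

(* Q_0 < Q_1 < ... < Q_h = P; the values Q_k with k > h are irrelevant. *)
Definition prime_chain (P : R -> Prop) (h : nat) (Q : nat -> R -> Prop) : Prop :=
  [/\ forall k, (k <= h)%N -> is_prime_ideal (Q k),
      forall k, (k < h)%N -> subideal (Q k) (Q k.+1) /\ ~ subideal (Q k.+1) (Q k)
    & eqideal (Q h) P].

Definition prime_height (P : R -> Prop) (h : nat) : Prop :=
  (exists Q, prime_chain P h Q) /\
  (forall h' Q, prime_chain P h' Q -> (h' <= h)%N).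

(* The minimum of the heights of the primes containing I; primes of infinite
   height, which do not occur in Noetherian rings, satisfy no prime_height. *)
Definition ideal_height (I : R -> Prop) (h : nat) : Prop :=
  (exists P, [/\ is_prime_ideal P, subideal I P & prime_height P h]) /\
  (forall P h', is_prime_ideal P -> subideal I P -> prime_height P h' ->
     (h <= h')%N).

(* P = (I : g) for some g, i.e. P is the annihilator of an element of R / I. *)
Definition associated_prime (I P : R -> Prop) : Prop :=
  is_prime_ideal P /\ exists g, forall f, P f <-> I (f * g).

Definition unmixed (I : R -> Prop) : Prop :=
  exists h, forall P, associated_prime I P -> prime_height P h.

Definition regular_sequence (s : seq R) : Prop :=
  (forall k g, (k < size s)%N ->
     ideal_of_seq (take k s) (g * s`_k) -> ideal_of_seq (take k s) g) /\
  ~ ideal_of_seq s 1.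

End Ideals.

Section GradedIdeals.

Variables (N : nat) (K : fieldType).

Definition homogeneous (f : {mpoly K[N]}) : Prop :=
  exists d : nat, f \is d.-homog.

(* A minimal system of generators of a graded ideal is understood to consist
   of homogeneous polynomials; minimality is with respect to inclusion (which
   for homogeneous generators is the same as minimality of the cardinality). *)
Definition minimal_generators (I : {mpoly K[N]} -> Prop)
    (s : seq {mpoly K[N]}) : Prop :=
  [/\ forall f, f \in s -> homogeneous f,
      eqideal (ideal_of_seq s) I
    & forall s', subseq s' s -> eqideal (ideal_of_seq s') I -> s' = s].

Definition monomial_order (le : rel 'X_{1..N}) : Prop :=
  [/\ total le, antisymmetric le, transitive le,
      forall m, le 0%MM m
    & forall m m1 m2, le m1 m2 -> le (m1 + m)%MM (m2 + m)%MM].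

(* The le-largest monomial of f; the default 0%MM is the least monomial, so it
   does not affect the maximum when f != 0. *)
Definition lead_monom (le : rel 'X_{1..N}) (f : {mpoly K[N]}) : 'X_{1..N} :=
  \big[(fun m1 m2 => if le m1 m2 then m2 else m1) / 0%MM]_(m <- msupp f) m.

Definition initial (le : rel 'X_{1..N}) (f : {mpoly K[N]}) : {mpoly K[N]} :=
  if f == 0 then 0 else 'X_[lead_monom le f].

Definition konig_type (I : {mpoly K[N]} -> Prop) : Prop :=
  exists h : nat, ideal_height I h /\
  exists fs : seq {mpoly K[N]},
    [/\ size fs = h,
        exists gs, minimal_generators I (fs ++ gs)
      & exists2 le : rel 'X_{1..N},
          monomial_order le & regular_sequence (map (initial le) fs)].

End GradedIdeals.

Section BinomialEdgeIdeal.

Variables (n : nat) (K : fieldType).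

Definition xvar (i : 'I_n) : {mpoly K[n + n]} := 'X_(lshift n i).

Definition yvar (i : 'I_n) : {mpoly K[n + n]} := 'X_(rshift n i).

Definition binomial_edge_ideal (e : rel 'I_n) : {mpoly K[n + n]} -> Prop :=
  ideal_gen (fun f => exists i j : 'I_n,
    [/\ (i < j)%N, e i j & f = xvar i * yvar j - xvar j * yvar i]).

End BinomialEdgeIdeal.

Arguments binomial_edge_ideal {n} K e _.

Section Graphs.

Variable n : nat.

Definition spanning_path (e : rel 'I_n) (C : {pred 'I_n}) : Prop :=
  exists (v : 'I_n) (p : seq 'I_n),
    [/\ path e v p, uniq (v :: p) & v :: p =i C].

Definition traceable (e : rel 'I_n) : Prop :=
  forall v : 'I_n, spanning_path e (connect e v).

Definition closed_labelling (e : rel 'I_n) : Prop :=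
  forall i j k l : 'I_n,
    e i j -> e k l -> [set i; j] != [set k; l] -> (i < j)%N -> (k < l)%N ->
    (i = k -> e j l) /\ (j = l -> e i k).

(* s a is the vertex carrying the label a. *)
Definition closed_graph (e : rel 'I_n) : Prop :=
  exists s : 'S_n, closed_labelling (fun a b => e (s a) (s b)).

End Graphs.

(* Main.v *)
From HB Require Import structures.
Require Import Defs.
From mathcomp Require Import all_boot all_order all_fingroup all_algebra.
From mathcomp Require Import ring zify.
From Stdlib Require Import ClassicalEpsilon.

Set Implicit Arguments.
Unset Strict Implicit.
Unset Printing Implicit Defensive.

Import GRing.Theory.
Local Open Scope ring_scope.

(** Write [J] for the binomial edge ideal and view the variables as the columns
    of a matrix with rows [x] and [y]; [J] is generated by the minors on the
    edges.  Let [P] be a prime over [J] and [S] the set of columns vanishing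
    modulo [P].  Over the remaining columns proportionality is transitive, so
    [P] contains the cut prime of [S], generated by the variables at [S] and all
    minors inside the components of the graph on the complement of [S]
    ([prime_over_cut]).  This cut prime is the kernel of a monomial map, which
    makes it prime, and its height is [n + |S| - c(S)], where [c(S)] is the
    number of those components ([cut_prime_height]).  The lower bound is an
    explicit chain of such kernels; the upper bound counts variables that stay
    algebraically independent modulo the prime ([prime_chain_dim]).  Hence the
    height of [J] is the minimum of [n + |S| - c(S)] ([edge_ideal_height]).

    Suppose that the graph has [c] components and is covered by vertex-disjoint
    paths, one in each component.  Every component left by the deletion of [S]
    contains a starting point of a path or the successor of a vertex of [S], so
    [c(S) <= c + |S|]: the height of [J] is [n - c], the number of edges of the
    paths ([cut_height_lower], [cut_height0_upper]).  Number the vertices along the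
    paths and order monomials by the resulting weight of their [y]-part.  The
    minors of the path edges [a -> b] get the initial monomials [x_a y_b], which
    are pairwise coprime, hence form a regular sequence; and the edge minors are
    a minimal generating system ([spanning_system_konig]).  A closed labelling
    turns each component, read in the order of the labels, into such a path
    ([closed_spanning_system]).

    Conversely let [J] be unmixed and of Koenig type.  The cut prime of the empty
    set and the cut primes of minimal height are associated primes
    ([cut_prime_associated]), so the height of [J] is again [n - c].  The members
    of the given sequence are quadrics in [J], so their initial monomials are
    some [x_a y_b] with [{a, b}] an edge and [x_b y_a] smaller; regularity makes
    them coprime, so every vertex has at most one successor [b] and at most one
    predecessor [a].  The order compares the ratios [x_a / y_a], which excludes
    cycles.  What remains are paths with [n - c] edges in total
    ([konig_path_system]); they have [c] starting points, one per component, so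
    each component is a single path. *)

(** * Ideals, quotients and chains of primes *)

Section IdealBasics.

Variable R : comNzRingType.
Implicit Types I P Q : R -> Prop.

Lemma idealN I f : is_ideal I -> I f -> I (- f).
Proof. by case=> _ _ IM If; rewrite -mulN1r; apply: IM. Qed.

Lemma idealB I f g : is_ideal I -> I f -> I g -> I (f - g).
Proof. by move=> idI If Ig; case: (idI) => _ ID _; apply: ID => //; apply: idealN. Qed.

Lemma ideal_sum I (J : Type) (r : seq J) (D : pred J) (F : J -> R) :
  is_ideal I -> (forall j, D j -> I (F j)) -> I (\sum_(j <- r | D j) F j).
Proof. by case=> I0 ID _ IF; elim/big_ind: _. Qed.

Lemma ideal_gen_ideal (S : R -> Prop) : is_ideal (ideal_gen S).
Proof.
split.
- by exists 0, (fun=> 0), (fun=> 0); split=> [[]|]; rewrite ?big_ord0.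
- move=> f1 f2 [m [a [g [Sg ->]]]] [m' [a' [g' [Sg' ->]]]].
  exists (m + m')%N, (fun i => match split i with inl j => a j | inr j => a' j end),
    (fun i => match split i with inl j => g j | inr j => g' j end); split.
    by move=> i; case: (split i).
  rewrite big_split_ord /=; congr (_ + _); apply: eq_bigr => i _.
    by rewrite -[lshift _ _]/(unsplit (inl i)) unsplitK.
  by rewrite -[rshift _ _]/(unsplit (inr i)) unsplitK.
- move=> c f [m [a [g [Sg ->]]]]; exists m, (fun i => c * a i), g; split=> //.
  by rewrite mulr_sumr; apply: eq_bigr => i _; rewrite mulrA.
Qed.

Lemma ideal_gen_mem (S : R -> Prop) f : S f -> ideal_gen S f.
Proof.
move=> Sf; exists 1, (fun=> 1), (fun=> f); split=> //.
by rewrite big_ord1 mul1r.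
Qed.

Lemma ideal_gen_min (S I : R -> Prop) :
  is_ideal I -> (forall f, S f -> I f) -> subideal (ideal_gen S) I.
Proof.
move=> idI SI f [m [a [g [Sg ->]]]]; apply: ideal_sum => // i _.
by case: idI => _ _; apply; apply: SI.
Qed.

Lemma prime_prod P (J : Type) (r : seq J) (F : J -> R) :
  is_prime_ideal P -> (forall j, ~ P (F j)) -> ~ P (\prod_(j <- r) F j).
Proof.
case=> _ P1 PM PF; elim/big_ind: _ => // f g Pf Pg /PM[].
  exact: Pf.
exact: Pg.
Qed.

Lemma prime_ker (S : idomainType) (phi : {rmorphism R -> S}) :
  is_prime_ideal (fun f => phi f = 0).
Proof.
split=> [|/eqP|f g /eqP]; first split=> [|f g f0 g0|a f f0].
- by rewrite rmorph0.
- by rewrite rmorphD f0 g0 addr0.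
- by rewrite rmorphM f0 mulr0.
- by rewrite rmorph1 oner_eq0.
- by rewrite rmorphM mulf_eq0 => /orP[]/eqP; [left | right].
Qed.

(** Quotients by an ideal are formed from boolean predicates; excluded middle
    provides one for an arbitrary ideal. *)
Definition mem_ideal I : {pred R} :=
  fun f => if excluded_middle_informative (I f) then true else false.

Lemma mem_idealP I f : reflect (I f) (f \in mem_ideal I).
Proof.
rewrite unfold_in /mem_ideal.
by case: excluded_middle_informative => If; constructor.
Qed.

Section Quotient.

Variables (I : R -> Prop) (idI : is_ideal I) (I1 : ~ I 1).

Lemma mem_ideal_closed : idealr_closed (mem_ideal I).
Proof.
case: (idI) => I0 ID IM; split; first exact/mem_idealP.
  by apply/mem_idealP.
move=> a f g /mem_idealP If /mem_idealP Ig; apply/mem_idealP.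
by apply: ID => //; apply: IM.
Qed.

(** A predicate that carries the proofs needed by its ideal structure. *)
Definition ideal_pred of is_ideal I & ~ I 1 : {pred R} := mem_ideal I.

HB.instance Definition _ :=
  isIdealr.Build R (ideal_pred idI I1) mem_ideal_closed.

Lemma residue_ring :
  exists (E : comNzRingType) (pi : {rmorphism R -> E}),
    forall f, pi f = 0 <-> I f.
Proof.
exists {ideal_quot (ideal_pred idI I1)}, \pi_{ideal_quot (ideal_pred idI I1)}%qT => f.
rewrite -(rmorph0 \pi_{ideal_quot (ideal_pred idI I1)}%qT).
split=> [/eqP|If]; last apply/eqP; rewrite -Quotient.idealrBE subr0.
  by move/mem_idealP.
exact/mem_idealP.
Qed.

End Quotient.
End IdealBasics.

Section Chains.

Variable R : comNzRingType.
Implicit Types (P : R -> Prop) (Q : nat -> R -> Prop).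

Lemma prime_chain_ext P P' h Q :
    prime_chain P h Q -> is_prime_ideal P' -> subideal P P' ->
    ~ subideal P' P ->
  exists Q', prime_chain P' h.+1 Q'.
Proof.
move=> [primeQ ltQ QP] primeP' leP ltP.
exists (fun k => if (k <= h)%N then Q k else P'); split=> [k _|k|]; last first.
- by rewrite ltnn.
- rewrite ltnS => le_kh; rewrite le_kh; case: ltnP => [|le_hk]; first exact: ltQ.
  have ->: k = h by apply/eqP; rewrite eqn_leq le_kh.
  by split=> [f /QP/leP //|leP']; apply: ltP => f /leP'/QP.
- by case: ifP => [|_ //]; apply: primeQ.
Qed.

(** The last member of the chain can be replaced by [P'], or [P'] appended. *)
Lemma prime_chain_height P P' h h' Q :
    prime_chain P h Q -> is_prime_ideal P' -> subideal P P' ->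
    prime_height P' h' ->
  (h <= h')%N.
Proof.
move=> chainP primeP' leP [_ maxP'].
have [leP'|ltP] := classic (subideal P' P); last first.
  by have [Q' /maxP'/ltnW] := prime_chain_ext chainP primeP' leP ltP.
apply: (maxP' _ Q); case: chainP => primeQ ltQ QP; split=> // f.
by split=> [/QP/leP|/leP'/QP].
Qed.

Lemma prime_height_uniq P h h' :
  prime_height P h -> prime_height P h' -> h = h'.
Proof.
case=> [[Q chQ] maxh] [[Q' chQ'] maxh'].
by apply/eqP; rewrite eqn_leq (maxh' _ _ chQ) (maxh _ _ chQ').
Qed.

End Chains.

(** * Substitutions and dimension *)

Section Substitution.

Variables (N : nat) (K : fieldType).
Local Notation R := {mpoly K[N]}.

(** Induction along the construction of polynomials from constants and variables
    by ring operations; it spares coefficient computations. *)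
Lemma mpoly_ind_ring (D : R -> Prop) :
    (forall c, D c%:MP) -> (forall i, D 'X_i) ->
    (forall f g, D f -> D g -> D (f + g)) ->
    (forall f g, D f -> D g -> D (f * g)) ->
  forall f, D f.
Proof.
move=> DC DX DD DM f; rewrite [f]mpolyE.
elim/big_ind: _ => [||m _]; [by rewrite -mpolyC0; apply: DC | exact: DD |].
rewrite -mul_mpolyC mpolyXE_id; apply/DM/(big_ind D) => // [|i _]; first exact: DC.
by elim: (m i) => [|k IHk]; rewrite ?expr0 -?mpolyC1 // exprS; apply: DM.
Qed.

Lemma mpoly_rmorph_ext (S : comNzRingType) (phi psi : {rmorphism R -> S}) :
    (forall c, phi c%:MP = psi c%:MP) -> (forall i, phi 'X_i = psi 'X_i) ->
  phi =1 psi.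
Proof.
move=> eqC eqX; apply: mpoly_ind_ring => // f g Ef Eg.
  by rewrite !rmorphD Ef Eg.
by rewrite !rmorphM Ef Eg.
Qed.

Definition subst (M : nat) (h : 'I_N -> {mpoly K[M]}) : R -> {mpoly K[M]} :=
  mmap (@mpolyC M K) h.

HB.instance Definition _ M h := GRing.RMorphism.copy (@subst M h)
  (mmap (@mpolyC M K) h).

Lemma substC M (h : 'I_N -> {mpoly K[M]}) c : subst h c%:MP = c%:MP.
Proof. exact: mmapC. Qed.

Lemma substX M (h : 'I_N -> {mpoly K[M]}) i : subst h 'X_i = h i.
Proof. by rewrite /subst mmapX mmap1U. Qed.

(** The retraction onto the polynomials in the variables indexed by [A]; its
    image stands for the subring [K[x_i : i in A]]. *)
Definition retract (A : {set 'I_N}) : R -> R :=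
  subst (fun i => if i \in A then 'X_i else 0).

HB.instance Definition _ A := GRing.RMorphism.copy (retract A)
  (subst (fun i => if i \in A then 'X_i else 0)).

Lemma retractX A i : retract A 'X_i = if i \in A then 'X_i else 0.
Proof. exact: substX. Qed.

Lemma retractC A c : retract A c%:MP = c%:MP.
Proof. exact: substC. Qed.

Lemma retract_id A f : retract A (retract A f) = retract A f.
Proof.
apply: (mpoly_rmorph_ext (phi := retract A \o retract A)) => [c|i] /=.
  by rewrite !retractC.
by rewrite !retractX; case: ifP => iA; rewrite ?retractX ?iA ?rmorph0.
Qed.

End Substitution.

Section Dimension.

Variables (N : nat) (K : fieldType).
Local Notation R := {mpoly K[N]}.
Implicit Types (P Q : R -> Prop) (A : {set 'I_N}).

Definition independent_mod P A :=
  forall f, P (retract A f) -> retract A f = 0.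

Section Algebraicity.

Variables (P : R -> Prop) (A : {set 'I_N}) (i : 'I_N).
Variables (E : comNzRingType) (pi : {rmorphism R -> E}).
Hypotheses (piP : forall f, pi f = 0 <-> P f) (indP : independent_mod P A).

Let iota : {rmorphism R -> E} := pi \o retract A.

(** [u] is algebraic over [K[x_i : i in A]], in the form that is stable under
    ring operations: some multiple of [u] by a nonzero coefficient is integral. *)
Definition almost_integral (u : E) :=
  exists2 c, retract A c != 0 & integralOver iota (iota c * u).

Lemma almost_integral_coef c : almost_integral (pi (retract A c)).
Proof.
exists 1; first by rewrite rmorph1 oner_eq0.
by rewrite rmorph1 mul1r; apply: (integral_id iota).
Qed.

Lemma almost_integralD u v :
  almost_integral u -> almost_integral v -> almost_integral (u + v).
Proof.
move=> [c c0 intu] [d d0 intv]; exists (c * d); first by rewrite rmorphM mulf_neq0.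
have ->: iota (c * d) * (u + v)
         = iota d * (iota c * u) + iota c * (iota d * v).
  by rewrite rmorphM; ring.
by apply: integral_add; apply: integral_mul => //; apply: integral_id.
Qed.

Lemma almost_integralM u v :
  almost_integral u -> almost_integral v -> almost_integral (u * v).
Proof.
move=> [c c0 intu] [d d0 intv]; exists (c * d); first by rewrite rmorphM mulf_neq0.
by rewrite rmorphM mulrACA; apply: integral_mul.
Qed.

(** A dependence relation, read as a polynomial equation for [x_i] over the
    coefficient ring, becomes monic after [x_i] is multiplied by its leading
    coefficient. *)
Lemma almost_integral_var :
  ~ independent_mod P (i |: A) -> almost_integral (pi 'X_i).
Proof.
move=> depP; have [g Pg g0]: exists2 g, P (retract (i |: A) g) & retract (i |: A) g != 0.
  apply: NNPP => nog; apply: depP => g Pg; apply/eqP/contraT => g0.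
  by case: nog; exists g.
(* [kappa] reads polynomials in the variables of [i |: A] as polynomials in
   [x_i] with coefficients in the other variables. *)
pose kappa : {rmorphism R -> {poly R}} :=
  mmap (@polyC R \o @mpolyC N K)
    (fun j => if j == i then 'X else if j \in A then ('X_j)%:P else 0).
have kappaX j : kappa 'X_j = if j == i then 'X else if j \in A then ('X_j)%:P else 0.
  by rewrite /kappa /= mmapX mmap1U.
have kappaC c : kappa c%:MP = c%:MP%:P by rewrite /kappa /= mmapC.
have kappaE : (kappa g).['X_i] = retract (i |: A) g.
  apply: (mpoly_rmorph_ext (phi := horner_eval 'X_i \o kappa)) => [c|j] /=.
    by rewrite kappaC /horner_eval hornerC retractC.
  rewrite kappaX retractX !inE /horner_eval; case: eqVneq => [->|_] /=.
    by rewrite hornerX.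
  by case: ifP; rewrite ?hornerC ?horner0.
have kappaA k : retract A (kappa g)`_k = (kappa g)`_k.
  have fixA: map_poly (retract A) \o kappa =1 kappa.
    apply: mpoly_rmorph_ext => [c|j] /=.
      by rewrite kappaC map_polyC /= retractC.
    rewrite kappaX; case: ifP => _; first by rewrite map_polyX.
    by case: ifP => jA; rewrite ?rmorph0 // map_polyC /= retractX jA.
  by rewrite -[in RHS]fixA /= coef_map.
move: (kappa g) kappaE kappaA => p pg pA.
have iotaE k : iota p`_k = pi p`_k by rewrite /= pA.
have p0: p != 0 by apply: contraNneq g0 => p0; rewrite -pg p0 horner0.
have [d szp]: exists d, size p = d.+2.
  case szp: (size p) => [|[|d]]; last by exists d.
    by move/eqP: szp; rewrite size_poly_eq0 (negPf p0).
  move: g0; rewrite -pg [p]size1_polyC ?szp // hornerC -pA indP ?eqxx //.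
  by rewrite pA -[p`_0](hornerC _ 'X_i) -size1_polyC ?szp // pg.
pose c := p`_d.+1.
exists c; first by rewrite pA -[d.+1]/(d.+2.-1) -szp -lead_coefE lead_coef_eq0.
(* [q(c t) = c ^ d p(t)], so [q] is monic and vanishes at [c x_i]. *)
pose q : {poly {mpoly K[N]}} := 'X^(d.+1) + \poly_(k < d.+1) (p`_k * c ^+ (d - k)).
exists q.
  rewrite monicE lead_coefDl ?lead_coefXn // size_polyXn ltnS.
  exact: size_poly.
have rp: pi c * pi 'X_i ^+ d.+1 + \sum_(k < d.+1) pi p`_k * pi 'X_i ^+ k = 0.
  have: pi (p.['X_i]) = 0 by apply/piP; rewrite pg.
  rewrite horner_coef szp big_ord_recr /= rmorphD rmorphM rmorphXn rmorph_sum /=.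
  rewrite addrC => rp; rewrite -[RHS]rp; congr (_ + _); apply: eq_bigr => k _.
  by rewrite rmorphM rmorphXn.
apply/rootP; rewrite rmorphD /= map_polyXn hornerD hornerXn.
rewrite (horner_coef_wide (n := d.+1)); last first.
  by rewrite (leq_trans (size_poly _ _)) // size_poly.
have := congr1 ( *%R (pi c ^+ d)) rp; rewrite /= mulr0 mulrDr mulr_sumr => {}rp.
rewrite -[RHS]rp; congr (_ + _); first by rewrite /= pA exprMn exprS; ring.
apply: eq_bigr => k _; rewrite coef_map coef_poly ltn_ord.
have iqE : iota (p`_k * c ^+ (d - k)) = pi p`_k * pi c ^+ (d - k).
  by rewrite rmorphM rmorphXn !iotaE.
rewrite [X in X * _](iqE : _ = _) {iqE}.
have -> : pi c ^+ d = pi c ^+ (d - k) * pi c ^+ k by rewrite -exprD subnK // -ltnS.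
by rewrite pA exprMn; ring.
Qed.

End Algebraicity.

(** If [A] cannot be enlarged, every polynomial is algebraic modulo [P] over
    [K[x_i : i in A]]; an element of [Q] outside [P] then has a relation whose
    lowest coefficient lies in [Q], hence vanishes. *)
Lemma independent_ext P Q A :
    is_prime_ideal P -> is_prime_ideal Q -> subideal P Q -> ~ subideal Q P ->
    independent_mod Q A ->
  exists2 i, i \notin A & independent_mod P (i |: A).
Proof.
move=> primeP primeQ lePQ ltPQ indQ; apply: NNPP => noext.
have indP: independent_mod P A by move=> f /lePQ/indQ.
have [f Qf Pf]: exists2 f, Q f & ~ P f.
  apply: NNPP => nof; apply: ltPQ => f Qf; apply: NNPP => Pf.
  by apply: nof; exists f.
case: (primeP) => idP P1 PM; case: (primeQ) => idQ Q1 QM.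
have [E [pi piP]] := residue_ring idP P1.
have algf g : almost_integral A pi (pi g).
  elim/mpoly_ind_ring: g => [c|i|g h|g h].
  - by rewrite -(retractC A); apply: almost_integral_coef.
  - have [iA|iA] := boolP (i \in A).
      have <- : retract A 'X_i = 'X_i :> R by rewrite retractX iA.
      exact: almost_integral_coef.
    by apply: almost_integral_var => // indPi; apply: noext; exists i.
  - by rewrite rmorphD; apply: almost_integralD.
  - by rewrite rmorphM; apply: almost_integralM.
(* [f] lies in [Q] but not in [P], so constant terms vanish one by one. *)
have noroot (a : {poly R}) :
    (forall k, retract A a`_k = a`_k) -> a != 0 -> ~ P a.[f].
  elim/poly_ind: a => [|a c IHa] aA; first by rewrite eqxx.
  have cA : retract A c = c.
    by have := aA 0%N; rewrite coefD coefMX coefC /= add0r.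
  have {aA} aA k : retract A a`_k = a`_k.
    by have := aA k.+1; rewrite coefD coefMX coefC /= addr0.
  move=> a0; rewrite hornerMXaddC => Pa.
  have c0: c = 0.
    rewrite -cA; apply: indQ; rewrite cA -[c](addKr (a.[f] * f)) addrC.
    by apply: (idealB idQ); [exact: lePQ | case: idQ => _ _; apply].
  move: Pa a0; rewrite c0 addr0 => /PM[Pa|//]; have [->|a0 _] := eqVneq a 0.
    by rewrite mul0r add0r eqxx.
  exact: IHa Pa.
have [c c0 [q monq rq]] := algf f.
apply: (noroot (\poly_(k < size q) retract A (q`_k * c ^+ k))).
- by move=> k; rewrite coef_poly; case: ifP; rewrite ?retract_id ?rmorph0.
- apply/eqP => /(congr1 (fun a : {poly R} => a`_(size q).-1)).
  rewrite coef_poly coef0 prednK ?size_poly_gt0 ?monic_neq0 // leqnn.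
  rewrite -lead_coefE (monicP monq) mul1r rmorphXn => /eqP.
  by rewrite expf_eq0 (negPf c0) andbF.
apply/piP; move/rootP: rq => {monq} <-.
rewrite (horner_coef_wide (n := size q)) ?size_poly //.
rewrite [RHS](horner_coef_wide (n := size q)) ?size_poly // rmorph_sum.
apply: eq_bigr => k _; rewrite coef_map coef_poly ltn_ord.
by rewrite !rmorphM !rmorphXn /= exprMn; ring.
Qed.

(** Going down a chain of primes, each step frees one more variable. *)
Lemma prime_chain_dim P h (Q : nat -> R -> Prop) A :
  prime_chain P h Q -> independent_mod P A -> (h + #|A| <= N)%N.
Proof.
move=> [primeQ ltQ QP] indP.
have: exists2 B : {set 'I_N}, independent_mod (Q 0%N) B & (h + #|A| <= #|B|)%N.
  have {QP}: independent_mod (Q h) A by move=> f /QP/indP.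
  elim: h A {indP} primeQ ltQ => [|h IHh] A primeQ ltQ indA; first by exists A.
  have [leQ nleQ] := ltQ h (ltnSn h).
  have [||i iA indiA] := independent_ext _ _ leQ nleQ indA; try exact: primeQ.
  have [k /leqW/primeQ//|k /leqW/ltQ//|B indB leB] := IHh _ _ _ indiA.
  by exists B => //; rewrite (leq_trans _ leB) // cardsU1 iA addSnnS.
by case=> B _ /leq_trans; apply; rewrite -[leqRHS](card_ord N) max_card.
Qed.

End Dimension.

(** * Toric parametrizations *)

Section Parametrization.

Variables (n : nat) (K : fieldType).
Local Notation R := {mpoly K[n + n]}.
Local Notation x := (xvar K).
Local Notation y := (yvar K).

Definition minor (i j : 'I_n) : R := x i * y j - x j * y i.

Lemma minorC i j : minor i j = - minor j i.
Proof. by rewrite /minor opprB. Qed.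

Lemma minor_ii i : minor i i = 0.
Proof. exact: subrr. Qed.

Lemma minor_coef i j m :
  (minor i j)@_m = (m == U_(lshift n i) + U_(rshift n j))%MM%:R
                   - (m == U_(lshift n j) + U_(rshift n i))%MM%:R.
Proof. by rewrite mcoeffB -!mpolyXD !mcoeffX !(eq_sym _ m). Qed.

Lemma eq_mnm_xy (i j k l : 'I_n) :
  (U_(lshift n i) + U_(rshift n j) == U_(lshift n k) + U_(rshift n l))%MM
  = (i == k) && (j == l).
Proof.
apply/eqP/andP => [/mnmP eq_m|[/eqP-> /eqP->]] //.
have := eq_m (lshift n i); have := eq_m (rshift n j).
rewrite !mnmDE !mnm1E !eqxx !eq_lrshift !eq_rlshift !eq_lshift !eq_rshift.
by rewrite !addn0 !add0n [k == i]eq_sym [l == j]eq_sym; case: (i == k); case: (j == l).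
Qed.

Lemma minor_neq0 i j : i != j -> minor i j != 0.
Proof.
move=> ij; apply/eqP => /(congr1 (mcoeff (U_(lshift n i) + U_(rshift n j))%MM)).
rewrite minor_coef eqxx eq_mnm_xy (negPf ij) mcoeff0 subr0 => /eqP.
by rewrite oner_eq0.
Qed.

Variant var_spec : 'I_(n + n) -> Type :=
  | VarX i : var_spec (lshift n i)
  | VarY i : var_spec (rshift n i).

Lemma varP w : var_spec w.
Proof. by rewrite -(splitK w); case: (split w) => i; constructor. Qed.

Definition vertex (w : 'I_(n + n)) : 'I_n :=
  match split w with inl i => i | inr i => i end.

Lemma vertex_x i : vertex (lshift n i) = i.
Proof. by rewrite /vertex -[lshift _ _]/(unsplit (inl i)) unsplitK. Qed.

Lemma vertex_y i : vertex (rshift n i) = i.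
Proof. by rewrite /vertex -[rshift _ _]/(unsplit (inr i)) unsplitK. Qed.

Section Param.

Variables (Z : {set 'I_(n + n)}) (rep : 'I_n -> 'I_n).

(** The variable [x_i] of a vertex [i] that is not a representative serves as the
    scalar by which its column is a multiple of the column of [rep i]. *)
Definition param_exp (w : 'I_(n + n)) : 'X_{1..n + n} :=
  match split w with
  | inl i => if rep i == i then U_(lshift n i)%MM
             else (U_(lshift n i) + U_(lshift n (rep i)))%MM
  | inr i => if rep i == i then U_(rshift n i)%MM
             else (U_(lshift n i) + U_(rshift n (rep i)))%MM
  end.

Lemma param_exp_x i : param_exp (lshift n i) =
  if rep i == i then U_(lshift n i)%MM
  else (U_(lshift n i) + U_(lshift n (rep i)))%MM.
Proof. by rewrite /param_exp -[lshift n i]/(unsplit (inl i)) unsplitK. Qed.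

Lemma param_exp_y i : param_exp (rshift n i) =
  if rep i == i then U_(rshift n i)%MM
  else (U_(lshift n i) + U_(rshift n (rep i)))%MM.
Proof. by rewrite /param_exp -[rshift n i]/(unsplit (inr i)) unsplitK. Qed.

(** A generic point of the variety on which the variables in [Z] vanish and the
    columns of each fibre of [rep] are proportional. *)
Definition param : R -> R :=
  subst (fun w => if w \in Z then 0 else 'X_[param_exp w]).

HB.instance Definition _ := GRing.RMorphism.copy param
  (subst (fun w => if w \in Z then 0 else 'X_[param_exp w])).

Lemma paramC c : param c%:MP = c%:MP. Proof. exact: substC. Qed.

Lemma paramX w : param 'X_w = if w \in Z then 0 else 'X_[param_exp w].
Proof. exact: substX. Qed.

Lemma param_x i : param (x i) =
  if lshift n i \in Z then 0 else if rep i == i then x i else x i * x (rep i).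
Proof. by rewrite paramX param_exp_x -mpolyXD; case: ifP => // _; case: ifP. Qed.

Lemma param_y i : param (y i) =
  if rshift n i \in Z then 0 else if rep i == i then y i else x i * y (rep i).
Proof. by rewrite paramX param_exp_y -mpolyXD; case: ifP => // _; case: ifP. Qed.

(** The values of [rep] are representatives, and a vertex with a variable in [Z]
    is alone in its block, so that no column is a multiple of a vanishing one. *)
Definition param_ok : Prop :=
  (forall i, rep (rep i) = rep i) /\
  (forall w, w \in Z -> forall i, rep i = rep (vertex w) -> i = vertex w).

End Param.

Definition param_ker Z rep (f : R) : Prop := param Z rep f = 0.

Lemma param_ker_prime Z rep : is_prime_ideal (param_ker Z rep).
Proof. exact: prime_ker. Qed.

(** Kernels grow along a factorization; a witness [g] makes the step strict. *)
Lemma ker_chain_step (S : idomainType) (phi phi' psi : {rmorphism S -> S}) g h :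
    phi =1 psi \o phi' -> phi' g != 0 -> phi g = 0 ->
    (exists Q, prime_chain (fun f => phi' f = 0) h Q) ->
  exists Q, prime_chain (fun f => phi f = 0) h.+1 Q.
Proof.
move=> phiE g' g0 [Q chQ]; apply: prime_chain_ext chQ _ _ _.
- exact: prime_ker.
- by move=> f f0; rewrite phiE /= f0 rmorph0.
- by move=> /(_ g g0) g0'; rewrite g0' eqxx in g'.
Qed.

Lemma param_ok_fixed Z rep w : param_ok Z rep -> w \in Z -> rep (vertex w) = vertex w.
Proof. by case=> repK Zfree wZ; apply: (Zfree w wZ); apply: repK. Qed.

Lemma param_ok_moved Z rep w i :
  param_ok Z rep -> w \in Z -> rep i != i ->
  (vertex w == i = false) * (vertex w == rep i = false).
Proof.
move=> ok wZ repi; split; apply: contraNF repi => /eqP E.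
  by rewrite -E (param_ok_fixed ok wZ) E.
by case: ok => repK Zfree; rewrite -E eq_sym; apply/eqP/(Zfree w wZ); rewrite E repK.
Qed.

(** The parametrization is a composite of elementary substitutions: [param_kill]
    splits off the death of a variable in [Z], [param_glue] the attachment of a
    vertex to its representative. *)
Lemma param_kill Z rep z : param_ok Z rep -> z \in Z ->
  param Z rep =1 subst (fun w => if w == z then 0 else 'X_w) \o param (Z :\ z) rep.
Proof.
move=> ok zZ; have fixz := param_ok_fixed ok zZ.
have movz i : rep i != i -> (vertex z == i = false) * (vertex z == rep i = false).
  exact: (param_ok_moved ok zZ).
have offx j : (vertex z == j) = false -> (lshift n j == z) = false.
  by apply: contraFF => /eqP <-; rewrite vertex_x.
have offy j : (vertex z == j) = false -> (rshift n j == z) = false.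
  by apply: contraFF => /eqP <-; rewrite vertex_y.
apply: mpoly_rmorph_ext => [c|w] /=; first by rewrite !paramC [RHS]substC.
rewrite !paramX !inE; case: (eqVneq w z) => [->|wz] /=.
  rewrite zZ; case: (varP z) fixz => i; rewrite ?vertex_x ?vertex_y => fixi.
    by rewrite param_exp_x fixi eqxx substX eqxx.
  by rewrite param_exp_y fixi eqxx substX eqxx.
case: ifP => _; first by rewrite rmorph0.
case: (varP w) wz => i iz.
  rewrite param_exp_x; case: (eqVneq (rep i) i) => [_|/movz[zi zr]].
    by rewrite substX (negPf iz).
  rewrite mpolyXD rmorphM /= !substX.
  by rewrite (offx _ zi) (offx _ zr).
rewrite param_exp_y; case: (eqVneq (rep i) i) => [_|/movz[zi zr]].
  by rewrite substX (negPf iz).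
rewrite mpolyXD rmorphM /= !substX.
by rewrite (offx _ zi) (offy _ zr).
Qed.

Lemma param_glue rep i : (forall j, rep (rep j) = rep j) -> rep i != i ->
  param set0 rep =1
    subst (fun w => if w == lshift n i then x i * x (rep i)
                    else if w == rshift n i then x i * y (rep i) else 'X_w)
    \o param set0 (fun j => if j == i then i else rep j).
Proof.
move=> repK repi.
have repNi j : (rep j == i) = false.
  by apply: contraNF repi => /eqP ri; rewrite -ri repK.
apply: mpoly_rmorph_ext => [c|w] /=; first by rewrite !paramC [RHS]substC.
rewrite !paramX !in_set0; case: (varP w) => j.
  rewrite !param_exp_x; case: (eqVneq j i) => [->|ji].
    by rewrite eqxx (negPf repi) substX eqxx mpolyXD.
  case: ifP => _; rewrite ?mpolyXD ?rmorphM /= !substX.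
    by rewrite eq_lshift eq_lrshift (negPf ji).
  by rewrite !eq_lshift !eq_lrshift (negPf ji) repNi.
rewrite !param_exp_y; case: (eqVneq j i) => [->|ji].
  by rewrite eqxx (negPf repi) substX eq_rlshift eqxx mpolyXD.
case: ifP => _; rewrite ?mpolyXD ?rmorphM /= !substX.
  by rewrite eq_rlshift eq_rshift (negPf ji).
by rewrite eq_lshift eq_lrshift eq_rlshift eq_rshift (negPf ji) repNi.
Qed.

Lemma xvar_neq0 (i : 'I_n) : x i != 0.
Proof. by rewrite -msupp_eq0 msuppX. Qed.

Lemma param_minor_fixed rep i j : rep i = i -> rep j = j ->
  param set0 rep (minor i j) = minor i j.
Proof.
by move=> fi fj; rewrite rmorphB !rmorphM /= !(param_x, param_y) !inE fi fj !eqxx.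
Qed.

Lemma param_minor_block Z rep i j : param_ok Z rep -> rep i = rep j ->
  param Z rep (minor i j) = 0.
Proof.
move=> ok rij; have [->|ij] := eqVneq i j; first by rewrite minor_ii rmorph0.
have [_ Zfree] := ok.
have col k l : k != l -> rep l = rep k ->
    exists a, param Z rep (x k) = a * x (rep k) /\ param Z rep (y k) = a * y (rep k).
  move=> kl rkl; have xZ : lshift n k \notin Z.
    apply: contraNN kl => kZ; rewrite eq_sym; apply/eqP.
    by rewrite -[RHS]vertex_x; apply: Zfree kZ _ _; rewrite vertex_x.
  have yZ : rshift n k \notin Z.
    apply: contraNN kl => kZ; rewrite eq_sym; apply/eqP.
    by rewrite -[RHS]vertex_y; apply: Zfree kZ _ _; rewrite vertex_y.
  rewrite param_x param_y (negPf xZ) (negPf yZ); case: eqP => [->|_].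
    by exists 1; rewrite !mul1r.
  by exists (x k).
have [a [ax ay]] := col i j ij (esym rij).
have [b [bx by_]] : exists b,
    param Z rep (x j) = b * x (rep j) /\ param Z rep (y j) = b * y (rep j).
  by apply: (col j i) => //; rewrite eq_sym.
by rewrite rmorphB !rmorphM /= ax ay bx by_ rij; ring.
Qed.

(** Undoing the elementary substitutions one at a time descends to the zero
    ideal; the killed variable, or the minor of an attached vertex and its
    representative, witnesses that the step is strict. *)
Lemma param_ker_chain Z rep : param_ok Z rep ->
  exists Q, prime_chain (param_ker Z rep) (#|Z| + #|[set i | rep i != i]|) Q.
Proof.
move: {2}(_ + _)%N (leqnn (#|Z| + #|[set i | rep i != i]|)) => k.
elim: k Z rep => [|k IHk] Z rep le_k ok.
  move: le_k; rewrite leqn0 => /eqP ->.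
  by exists (fun _ => param_ker Z rep); split=> // i _; apply: param_ker_prime.
have [Z0|[z zZ]] := set_0Vmem Z; last first.
  have cZ : #|Z| = #|Z :\ z|.+1 by rewrite (cardsD1 z) zZ.
  have fixz := param_ok_fixed ok zZ.
  rewrite cZ addSn; apply: (ker_chain_step (g := 'X_z) (param_kill ok zZ)).
  - rewrite /= paramX !inE eqxx /=; case: (varP z) fixz => i; rewrite ?vertex_x ?vertex_y => fixi.
      by rewrite param_exp_x fixi eqxx -msupp_eq0 msuppX.
    by rewrite param_exp_y fixi eqxx -msupp_eq0 msuppX.
  - by rewrite /= paramX zZ.
  apply: IHk; first by rewrite -ltnS -addSn -cZ.
  by case: ok => repK Zfree; split=> // w /setD1P[_ /Zfree].
have [fix_all|[i]] := set_0Vmem [set i | rep i != i].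
  rewrite Z0 fix_all !cards0; exists (fun _ => param_ker set0 rep).
  by split=> // i _; apply: param_ker_prime.
rewrite inE => repi; subst Z; case: ok => repK _.
pose rep' j := if j == i then i else rep j.
have cardE : #|[set j | rep j != j]| = #|[set j | rep' j != j]|.+1.
  rewrite (cardsD1 i) inE repi; congr _.+1; apply: eq_card => j.
  by rewrite !inE /rep'; case: eqVneq => [->|_]; rewrite ?eqxx.
have repNi j : (rep j == i) = false.
  by apply: contraNF repi => /eqP ri; rewrite -ri repK.
rewrite cardE addnS; apply: (ker_chain_step (g := minor i (rep i)) (param_glue repK repi)).
- rewrite /= param_minor_fixed ?eqxx ?repNi ?repK //.
  by apply: minor_neq0; rewrite eq_sym.
- by apply: param_minor_block; rewrite ?repK //; split=> // w; rewrite inE.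
apply: IHk; first by rewrite -ltnS -addnS -cardE.
split=> [j|w]; last by rewrite inE.
by case: (eqVneq j i) => [_|ji]; rewrite ?eqxx // repNi.
Qed.

End Parametrization.

Section ParametrizationKernel.

Variables (n : nat) (K : fieldType).
Local Notation R := {mpoly K[n + n]}.
Local Notation x := (xvar K).
Local Notation y := (yvar K).
Variables (Z : {set 'I_(n + n)}) (rep : 'I_n -> 'I_n).

(** A transcendence basis modulo the kernel: the surviving first coordinates, and
    the second coordinates of the representatives. *)
Definition free_vars : {set 'I_(n + n)} :=
  ~: (Z :|: [set rshift n i | i in [set i | rep i != i]]).

Lemma free_x i : lshift n i \in free_vars = (lshift n i \notin Z).
Proof.
rewrite !inE negb_or [X in _ && ~~ X](_ : _ = false) ?andbT //.
by apply/imsetP => -[j _ /eqP]; rewrite eq_lrshift.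
Qed.

Lemma free_y i :
  rshift n i \in free_vars = (rshift n i \notin Z) && (rep i == i).
Proof.
rewrite !inE negb_or mem_imset ?inE ?negbK //.
by move=> j k /eqP; rewrite eq_rshift => /eqP.
Qed.

(** Dividing [x_i] by the first coordinate of its representative inverts the
    parametrization on the polynomials in the free variables. *)
Lemma param_ker_independent :
  param_ok Z rep -> independent_mod (@param_ker n K Z rep) free_vars.
Proof.
move=> ok; have [repK _] := ok.
pose F := {fraction R}; pose frac : {rmorphism R -> F} := @tofrac R.
(* A representative is sent to itself, a scalar [x_i] to the quotient that it
   stands for. *)
pose theta : {rmorphism R -> F} := mmap (frac \o @mpolyC (n + n) K)
  (fun w => match split w with
            | inl i => if rep i == i then frac (x i) else frac (x i) / frac (x (rep i))
            | inr i => frac (y i) end).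
have theta_x i : theta (x i) =
    if rep i == i then frac (x i) else frac (x i) / frac (x (rep i)).
  by rewrite /theta /= mmapX mmap1U -[lshift n i]/(unsplit (inl i)) unsplitK.
have theta_y i : theta (y i) = frac (y i).
  by rewrite /theta /= mmapX mmap1U -[rshift n i]/(unsplit (inr i)) unsplitK.
have inv : theta \o (param Z rep \o retract free_vars) =1 frac \o retract free_vars.
  apply: mpoly_rmorph_ext => [c|w] /=.
    by rewrite retractC paramC /theta /= mmapC.
  rewrite retractX; case: ifP => wA; last by rewrite !rmorph0.
  case: (varP w) wA => i; rewrite (free_x, free_y).
    move=> xZ; rewrite -/(xvar K i) param_x (negPf xZ).
    case: (eqVneq (rep i) i) => ri; first by rewrite theta_x ri eqxx.
    rewrite rmorphM !theta_x repK eqxx (negPf ri) mulfVK //.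
    by rewrite /frac /= tofrac_eq0 xvar_neq0.
  by case/andP=> yZ ri; rewrite -/(yvar K i) param_y (negPf yZ) ri theta_y.
move=> f f0; apply/eqP; rewrite -tofrac_eq0 -[tofrac _]/((frac \o _) f) -inv /=.
by rewrite [param _ _ _]f0 rmorph0.
Qed.

Lemma param_ker_height : param_ok Z rep ->
  prime_height (@param_ker n K Z rep) (#|Z| + #|[set i | rep i != i]|).
Proof.
move=> ok; split; first exact: param_ker_chain.
move=> h Q chQ; have := prime_chain_dim chQ (param_ker_independent ok).
rewrite -[X in (_ <= X)%N]card_ord.
rewrite -(cardsC (Z :|: [set rshift n i | i in [set i | rep i != i]])).
rewrite leq_add2r => /leq_trans; apply.
by apply: leq_trans (leq_card_setU _ _) _; rewrite leq_add2l leq_imset_card.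
Qed.

Definition param_mon (m : 'X_{1..n + n}) : 'X_{1..n + n} :=
  (\sum_w param_exp rep w *+ m w)%MM.

Lemma param_monomial (m : 'X_{1..n + n}) :
  param Z rep 'X_[K, m] = if [forall w in Z, m w == 0%N] then 'X_[param_mon m] else 0.
Proof.
rewrite mpolyXE_id rmorph_prod /=; case: ifPn => [/forall_inP mZ|].
  rewrite /param_mon -mprodXnE; apply: eq_bigr => w _.
  rewrite rmorphXn /= paramX; case: ifP => // /mZ/eqP ->; rewrite expr0.
  by [].
rewrite negb_forall => /existsP[w]; rewrite negb_imply => /andP[wZ mw].
by rewrite (bigD1 w) //= rmorphXn /= paramX wZ expr0n (negPf mw) mul0r.
Qed.

Lemma param_mon_y (m : 'X_{1..n + n}) r : rep r = r ->
  param_mon m (rshift n r) = (\sum_(i | rep i == r) m (rshift n i))%N.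
Proof.
move=> fr; rewrite mnm_sumE big_split_ord /= big1 ?add0n => [|i _]; last first.
  by rewrite mulmnE param_exp_x; case: ifP => _; rewrite ?mnmDE !mnm1E !eq_lrshift.
rewrite [RHS]big_mkcond; apply: eq_bigr => i _.
rewrite mulmnE param_exp_y; case: (eqVneq (rep i) i) => ri.
  by rewrite mnm1E eq_rshift ri; case: eqP; rewrite ?mul1n ?mul0n.
by rewrite mnmDE !mnm1E eq_lrshift eq_rshift; case: eqP; rewrite ?mul1n ?mul0n.
Qed.

Lemma param_mon_x (m : 'X_{1..n + n}) r : rep r = r ->
  param_mon m (lshift n r) = (\sum_(i | rep i == r) m (lshift n i))%N.
Proof.
move=> fr; rewrite mnm_sumE big_split_ord /= [X in (_ + X)%N]big1 ?addn0 => [|i _]; last first.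
  rewrite mulmnE param_exp_y; case: (eqVneq (rep i) i) => ri.
    by rewrite mnm1E eq_rlshift.
  rewrite mnmDE !mnm1E eq_rlshift eq_lshift.
  have -> : (i == r) = false by apply: contraNF ri => /eqP ->; rewrite fr.
  by [].
rewrite [RHS]big_mkcond; apply: eq_bigr => i _.
rewrite mulmnE param_exp_x; case: (eqVneq (rep i) i) => ri.
  by rewrite mnm1E eq_lshift ri; case: eqP; rewrite ?mul1n ?mul0n.
rewrite mnmDE !mnm1E !eq_lshift.
have -> : (i == r) = false by apply: contraNF ri => /eqP ->; rewrite fr.
by case: eqP; rewrite ?mul1n ?mul0n.
Qed.

Lemma param_mon_deg (m : 'X_{1..n + n}) i : (forall j, rep (rep j) = rep j) ->
  rep i != i -> param_mon m (lshift n i) = (m (lshift n i) + m (rshift n i))%N.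
Proof.
move=> repK ri; have nrep j : (rep j == i) = false.
  by apply: contraNF ri => /eqP <-; rewrite repK.
rewrite mnm_sumE big_split_ord /=; congr (_ + _)%N.
  rewrite (bigD1 i) //= big1 ?addn0 => [|j ji].
    by rewrite mulmnE param_exp_x (negPf ri) mnmDE !mnm1E !eq_lshift eqxx nrep mul1n.
  rewrite mulmnE param_exp_x; case: ifP => _; rewrite ?mnmDE !mnm1E !eq_lshift.
    by rewrite (negPf ji).
  by rewrite (negPf ji) nrep.
rewrite (bigD1 i) //= big1 ?addn0 => [|j ji].
  by rewrite mulmnE param_exp_y (negPf ri) mnmDE !mnm1E eq_lshift eq_rlshift eqxx mul1n.
rewrite mulmnE param_exp_y; case: ifP => _; rewrite ?mnmDE !mnm1E ?eq_lshift eq_rlshift //.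
by rewrite (negPf ji).
Qed.

Section Congruence.

Variable I : R -> Prop.
Hypotheses (idI : is_ideal I) (repK : forall i, rep (rep i) = rep i).
Hypothesis minorI : forall i j, rep i = rep j -> I (minor K i j).

(** Exchanging [x_j y_i] for [x_i y_j] inside a block changes a monomial by a
    multiple of a minor and brings its [y]-exponents closer to the target. *)
Lemma block_monomials_congr (m m' : 'X_{1..n + n}) :
    (forall i, m (lshift n i) + m (rshift n i)
               = m' (lshift n i) + m' (rshift n i))%N ->
    (forall r, \sum_(i | rep i == r) m (rshift n i)
               = \sum_(i | rep i == r) m' (rshift n i))%N ->
  I ('X_[m] - 'X_[m']).
Proof.
move: {2}(\sum_i (m (rshift n i) - m' (rshift n i)))%N
  (leqnn (\sum_i (m (rshift n i) - m' (rshift n i)))%N) => k.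
elim: k m => [|k IHk] m le_k degE sumE.
  suff -> : m = m' by rewrite subrr; case: idI.
  have le_y i : (m (rshift n i) <= m' (rshift n i))%N.
    by move: le_k; rewrite leqn0 sum_nat_eq0 => /forallP/(_ i).
  have eq_y i : m (rshift n i) = m' (rshift n i).
    have [_] := leqif_sum (fun j (_ : rep j == rep i) => leqif_eq (le_y j)).
    by rewrite sumE eqxx => /esym/forall_inP/(_ i (eqxx _))/eqP.
  apply/mnmP => w; case: (varP w) => i //.
  by have := degE i; rewrite eq_y => /addIn.
have [/forallP le_y|] := boolP [forall i, m (rshift n i) <= m' (rshift n i)]%N.
  by apply: IHk => //; rewrite big1 // => i _; apply/eqP/le_y.
rewrite negb_forall => /existsP[i]; rewrite -ltnNge => lt_i.
have [j rij lt_j]: exists2 j, rep i = rep j & (m (rshift n j) < m' (rshift n j))%N.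
  have [/existsP[j /andP[/eqP rj ltj]]|] :=
    boolP [exists j, (rep j == rep i) && (m (rshift n j) < m' (rshift n j))%N].
    by exists j.
  rewrite negb_exists => /forallP ge_y.
  suff: (\sum_(j | rep j == rep i) m' (rshift n j)
         < \sum_(j | rep j == rep i) m (rshift n j))%N.
    by rewrite sumE ltnn.
  rewrite (bigD1 i) //= [X in (_ < X)%N](bigD1 i) //= -addSn leq_add // leq_sum // => j /andP[rj _].
  by have := ge_y j; rewrite rj /= -leqNgt.
have ij : i != j by apply: contraTneq lt_i => ->; rewrite -leqNgt ltnW.
have lt_xj : (0 < m (lshift n j))%N.
  by have := degE j; move: lt_j; lia.
pose d := (m - (U_(lshift n j) + U_(rshift n i)))%MM.
have mE : m = (d + (U_(lshift n j) + U_(rshift n i)))%MM.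
  rewrite submK //; apply/mnm_lepP => w; rewrite mnmDE !mnm1E.
  case: (varP w) => l; rewrite !(eq_lshift, eq_rshift, eq_lrshift, eq_rlshift) ?addn0 ?add0n.
    by case: eqP => // <-.
  by case: eqP => // <-; apply: leq_ltn_trans lt_i.
pose m1 := (d + (U_(lshift n i) + U_(rshift n j)))%MM.
have m1x l : (m1 (lshift n l) + (j == l) = m (lshift n l) + (i == l))%N.
  by rewrite mE !mnmDE !mnm1E !(eq_lshift, eq_rlshift) !addn0 addnAC.
have m1y l : (m1 (rshift n l) + (i == l) = m (rshift n l) + (j == l))%N.
  by rewrite mE !mnmDE !mnm1E !(eq_lrshift, eq_rshift) !add0n addnAC.
rewrite -(subrK 'X_[m1] 'X_[m]) -addrA; case: (idI) => _ ID IM; apply: ID.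
  rewrite mE /m1 !mpolyXD -mulrBr; apply: IM.
  by have := minorI (esym rij); rewrite /minor.
apply: IHk.
- rewrite -ltnS; apply: leq_trans le_k; rewrite (bigD1 i) //= [X in (_ < X)%N](bigD1 i) //=.
  rewrite -addSn leq_add //.
    by have := m1y i; rewrite eqxx eq_sym (negPf ij); move: lt_i; lia.
  apply: leq_sum => l li; have := m1y l; rewrite eq_sym (negPf li).
  by case: eqP => [<-|_]; move: lt_j; lia.
- by move=> l; rewrite -degE; have := m1x l; have := m1y l; lia.
move=> r; rewrite -sumE.
have : (\sum_(l | rep l == r) (m1 (rshift n l) + (i == l))
        = \sum_(l | rep l == r) (m (rshift n l) + (j == l)))%N.
  by apply: eq_bigr => l _; apply: m1y.
rewrite !big_split /=.
have -> : (\sum_(l | rep l == r) (i == l) = \sum_(l | rep l == r) (j == l))%N.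
  have dl a : (\sum_(l | rep l == r) (a == l) = (rep a == r))%N.
    have [ar|ar] := eqVneq (rep a) r.
      rewrite (bigD1 a) ?ar //= eqxx big1 // => l /andP[_ la].
      by rewrite eq_sym (negPf la).
    rewrite big1 // => l /eqP rl; case: eqP => // al.
    by rewrite al rl eqxx in ar.
  by rewrite !dl rij.
by move/addIn.
Qed.

Hypothesis varI : forall w, w \in Z -> I 'X_w.

(** The image of a monomial determines the [y]-degree of every block and the
    degree of every column: for a representative the latter is what remains of
    the degree of its block. *)
Lemma param_mon_congr (m m' : 'X_{1..n + n}) :
  param_mon m = param_mon m' -> I ('X_[m] - 'X_[m']).
Proof.
move=> eqm.
have sum_y r : (\sum_(i | rep i == r) m (rshift n i)
               = \sum_(i | rep i == r) m' (rshift n i))%N.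
  have [fr|fr] := eqVneq (rep r) r; first by rewrite -!param_mon_y // eqm.
  by rewrite !big_pred0 // => i; apply: contraNF fr => /eqP <-; rewrite repK.
apply: block_monomials_congr => // i.
have [fi|fi] := eqVneq (rep i) i; last by rewrite -!param_mon_deg // eqm.
have : (\sum_(j | rep j == i) (m (lshift n j) + m (rshift n j))
     = \sum_(j | rep j == i) (m' (lshift n j) + m' (rshift n j)))%N.
  by rewrite !big_split /= sum_y -!param_mon_x // eqm.
rewrite (bigD1 i) ?fi //= [X in _ = X -> _](bigD1 i) ?fi //=.
rewrite [X in (_ + X = _ -> _)%N](eq_bigr (fun j => m' (lshift n j) + m' (rshift n j))%N).
  by move/addIn.
move=> j /andP[/eqP rj ji].
have mj : rep j != j by rewrite rj eq_sym.
by rewrite -!param_mon_deg ?eqm.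
Qed.

(** The kernel is generated by the variables in [Z] and the minors inside the
    blocks: a polynomial in the kernel is emptied monomial by monomial, since a
    monomial outside [(Z)] has a partner with the same image. *)
Lemma param_ker_sub : subideal (param_ker Z rep) I.
Proof.
move=> f; move: {2}(size (msupp f)) (leqnn (size (msupp f))) => k.
have [I0 ID IM] := idI.
elim: k f => [|k IHk] f.
  by rewrite leqn0 size_eq0 msupp_eq0 => /eqP ->.
have [->//|f0] := eqVneq f 0.
have [m mf] : exists m, m \in msupp f.
  by move: f0; rewrite -msupp_eq0; case: (msupp f) => // m s _; exists m; rewrite mem_head.
move=> le_k fker.
have shrink g : {subset msupp g <= rem m (msupp f)} -> (size (msupp g) <= k)%N.
  move=> sub; have := uniq_leq_size (msupp_uniq g) sub.
  rewrite size_rem // => /leq_trans; apply.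
  by case: (size (msupp f)) le_k.
have [/forall_inP mZ|] := boolP [forall w in Z, m w == 0%N]; last first.
  rewrite negb_forall => /existsP[w]; rewrite negb_imply => /andP[wZ mw].
  have Im : I 'X_[m].
    have -> : m = ((m - U_(w)) + U_(w))%MM by rewrite submK // lep1mP.
    by rewrite mpolyXD; apply/IM/varI.
  rewrite -(subrK (f@_m *: 'X_[m]) f); apply: ID; last by rewrite -mul_mpolyC; apply: IM.
  apply: IHk.
    apply: shrink => u; rewrite mem_rem_uniq ?msupp_uniq // !inE !mcoeff_msupp.
    rewrite mcoeffB mcoeffZ mcoeffX; case: (eqVneq m u) => [<-|_]; first by rewrite mulr1 subrr eqxx.
    by rewrite mulr0 subr0.
  rewrite /param_ker rmorphB -mul_mpolyC rmorphM /= param_monomial fker.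
  rewrite ifF ?mulr0 ?subr0 //; apply/negbTE; rewrite negb_forall; apply/existsP.
  by exists w; rewrite wZ mw.
(* Otherwise nothing would cancel the image of the monomial [m]. *)
have [m' [m'f m'm mm' m'Z]] : exists m', [/\ m' \in msupp f, m' != m,
    param_mon m = param_mon m' & [forall w in Z, m' w == 0%N]].
  apply: NNPP => nom'.
  have : (param Z rep f)@_(param_mon m) = 0 by rewrite fker mcoeff0.
  rewrite [f in param _ _ f](mpolyE f) rmorph_sum /= raddf_sum /=.
  rewrite (bigD1_seq m) ?msupp_uniq //=.
  rewrite -mul_mpolyC rmorphM /= paramC param_monomial ifT; last exact/forall_inP.
  rewrite mul_mpolyC mcoeffZ mcoeffX eqxx mulr1 big1_seq ?addr0 => [/eqP|m' /andP[m'm m'f]].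
    by rewrite mcoeff_eq0 mf.
  rewrite -mul_mpolyC rmorphM /= paramC param_monomial mul_mpolyC mcoeffZ.
  case: ifP => m'Z; rewrite ?mcoeff0 ?mulr0 // mcoeffX.
  case: eqP => [mm'|]; rewrite ?mulr0 //.
  by case: nom'; exists m'.
rewrite -(subrK (f@_m *: ('X_[m] - 'X_[m'])) f); apply: ID; last first.
  by rewrite -mul_mpolyC; apply/IM/param_mon_congr.
apply: IHk.
  apply: shrink => u; rewrite mem_rem_uniq ?msupp_uniq // !inE mcoeff_msupp.
  rewrite mcoeffB mcoeffZ mcoeffB !mcoeffX.
  have [<-|um] := eqVneq m u; first by rewrite (negPf m'm) subr0 mulr1 subrr eqxx.
  have [<-|_] := eqVneq m' u; first by rewrite m'f.
  by rewrite subrr mulr0 subr0 mcoeff_msupp.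
rewrite /param_ker rmorphB -mul_mpolyC rmorphM /= rmorphB /= !param_monomial fker m'Z.
by rewrite ifT ?mm' ?subrr ?mulr0 ?subrr //; apply/forall_inP.
Qed.

End Congruence.

End ParametrizationKernel.

(** * Cut primes and the height of the binomial edge ideal *)

Lemma connect_ind (T : finType) (e : rel T) (D : T -> T -> Prop) :
    (forall i, D i i) -> (forall i j k, e i j -> D j k -> D i k) ->
  forall i j, connect e i j -> D i j.
Proof.
move=> D0 DS i j /connectP[p ep ->]; elim: p i ep => [|k p IHp] i //=.
by case/andP=> eik /IHp; apply: DS.
Qed.

Section CutPrimes.

Variables (n : nat) (K : fieldType) (e : rel 'I_n).
Hypotheses (e_sym : symmetric e) (e_irr : irreflexive e).
Local Notation R := {mpoly K[n + n]}.
Local Notation x := (xvar K).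
Local Notation y := (yvar K).
Local Notation minor := (minor K).
Local Notation J := (binomial_edge_ideal K e).
Local Notation root := fingraph.root.

Lemma edge_ideal_ideal : is_ideal J.
Proof. exact: ideal_gen_ideal. Qed.

Lemma edge_ideal_minor i j : e i j -> J (minor i j).
Proof.
move=> eij; have [lt_ij|lt_ji|/val_inj E] := ltngtP i j; last by rewrite E e_irr in eij.
  by apply: ideal_gen_mem; exists i, j.
rewrite minorC; apply: (idealN edge_ideal_ideal); apply: ideal_gen_mem.
by exists j, i; rewrite e_sym.
Qed.

Lemma edge_ideal_min (I : R -> Prop) :
  is_ideal I -> (forall i j, e i j -> I (minor i j)) -> subideal J I.
Proof.
by move=> idI minI; apply: ideal_gen_min => // f [i [j [_ /minI If ->]]].
Qed.

Implicit Types (S : {set 'I_n}) (P : R -> Prop).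

Definition del S : rel 'I_n := fun i j => [&& e i j, i \notin S & j \notin S].

Lemma del_sym S : symmetric (del S).
Proof. by move=> i j; rewrite /del e_sym [(i \notin S) && _]andbC. Qed.

Lemma del_connect_sym S : connect_sym (del S).
Proof. exact/sym_connect_sym/del_sym. Qed.

Lemma del_rootP S i j : reflect (connect (del S) i j) (root (del S) i == root (del S) j).
Proof. by rewrite (root_connect (@del_connect_sym S)); apply: idP. Qed.

Lemma del_connect_isolated S i j : j \in S -> connect (del S) i j -> i = j.
Proof.
move=> jS; rewrite (del_connect_sym S) => /connectP[[|k p] //=].
by rewrite /del jS andbF.
Qed.

Definition cut_vars S : {set 'I_(n + n)} := [set w | vertex w \in S].

Lemma card_cut_vars S : #|cut_vars S| = (#|S| + #|S|)%N.
Proof.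
have -> : cut_vars S = [set lshift n i | i in S] :|: [set rshift n i | i in S].
  apply/setP => w; rewrite !inE; case: (varP w) => i; rewrite ?vertex_x ?vertex_y.
    rewrite mem_imset; last exact: lshift_inj.
    by case: imsetP => [[j _ /eqP]|]; rewrite ?eq_lrshift // orbF.
  rewrite mem_imset; last exact: rshift_inj.
  by case: imsetP => [[j _ /eqP]|]; rewrite ?eq_rlshift.
rewrite cardsU disjoint_setI0 ?cards0 ?subn0.
  by rewrite !card_imset //; [exact: rshift_inj | exact: lshift_inj].
apply/pred0P => w /=; apply/andP => -[/imsetP[i _ ->] /imsetP[j _ /eqP]].
by rewrite eq_lrshift.
Qed.

(** The minimal primes of [J] are among these: the ideals generated by the
    variables at [S] and the minors of the components of the graph on [~: S]. *)
Definition cut_prime S : R -> Prop :=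
  param_ker (cut_vars S) (root (del S)).

(** As the vertices of [S] are isolated in [del S], this is
    [n + |S| - c(S)] with [c(S)] the number of components on [~: S]. *)
Definition cut_height S := (#|S| + #|S| + #|[set i | root (del S) i != i]|)%N.

Lemma cut_param_ok S : param_ok (cut_vars S) (root (del S)).
Proof.
split=> [i|w]; first exact/root_root/del_connect_sym.
by rewrite inE => wS i /eqP/del_rootP; apply: del_connect_isolated.
Qed.

Lemma cut_prime_prime S : is_prime_ideal (cut_prime S).
Proof. exact: param_ker_prime. Qed.

Lemma cut_prime_height S : prime_height (cut_prime S) (cut_height S).
Proof.
by rewrite /cut_height -card_cut_vars; apply/param_ker_height/cut_param_ok.
Qed.

Lemma cut_prime_edge S : subideal J (cut_prime S).
Proof.
have [idP _ _] := cut_prime_prime S.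
apply: edge_ideal_min => // i j eij.
have dead k : k \in S -> cut_prime S (x k) /\ cut_prime S (y k).
  by move=> kS; rewrite /cut_prime /param_ker param_x param_y !inE vertex_x vertex_y kS.
have [iS|iS] := boolP (i \in S).
  have [xi yi] := dead i iS; case: (idP) => _ _ IM.
  by apply: (idealB idP); rewrite ?[x i * _]mulrC; apply: IM.
have [jS|jS] := boolP (j \in S).
  have [xj yj] := dead j jS; case: (idP) => _ _ IM.
  by apply: (idealB idP); rewrite ?[x j * _]mulrC; apply: IM.
apply: param_minor_block; first exact: cut_param_ok.
by apply/eqP/del_rootP/connect1/and3P.
Qed.

(** The linear relation between three vectors of the plane, by coordinates. *)
Lemma minor_x_trans (i j k : 'I_n) :
  x j * minor i k = x i * minor j k + x k * minor i j.
Proof. by rewrite /minor; ring. Qed.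

Lemma minor_y_trans (i j k : 'I_n) :
  y j * minor i k = y i * minor j k + y k * minor i j.
Proof. by rewrite /minor; ring. Qed.

(** Modulo [P], adjacent columns are proportional; away from the set of
    vanishing columns proportionality is transitive. *)
Lemma prime_over_cut P : is_prime_ideal P -> subideal J P ->
  exists S, subideal (cut_prime S) P.
Proof.
move=> primeP leP; have [idP P1 PM] := primeP; have [P0 PD PA] := idP.
pose S := [set i | (x i \in mem_ideal P) && (y i \in mem_ideal P)].
have SP i : i \in S <-> P (x i) /\ P (y i).
  rewrite inE; split=> [/andP[/mem_idealP ? /mem_idealP]|[? ?]] //.
  by apply/andP; split; apply/mem_idealP.
exists S; apply: param_ker_sub => //.
- by move=> i; apply/root_root/del_connect_sym.
- move=> i j /eqP/del_rootP; elim/connect_ind: i j / => [i|i j k /and3P[eij _ jS] Pjk].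
    by rewrite minor_ii.
  have Pij : P (minor i j) by apply/leP/edge_ideal_minor.
  have: P (x j * minor i k) by rewrite minor_x_trans; apply: PD; apply: PA.
  have: P (y j * minor i k) by rewrite minor_y_trans; apply: PD; apply: PA.
  by move=> /PM[Py|//] /PM[Px|//]; case/negP: jS; apply/SP.
- move=> w; rewrite inE; case: (varP w) => i; rewrite ?vertex_x ?vertex_y => /SP[Px Py].
    exact: Px.
  exact: Py.
Qed.

Lemma ideal_height_uniq (I : R -> Prop) h h' :
  ideal_height I h -> ideal_height I h' -> h = h'.
Proof.
case=> [[P [primeP leP htP]] minh] [[P' [primeP' leP' htP']] minh'].
by apply/eqP; rewrite eqn_leq (minh _ _ primeP' leP' htP') (minh' _ _ primeP leP htP).
Qed.

(** Every prime over [J] contains a cut prime, so the smallest height of a cut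
    prime is the height of [J]. *)
Lemma edge_ideal_height S0 : (forall S, cut_height S0 <= cut_height S)%N ->
  ideal_height J (cut_height S0).
Proof.
move=> minS0; split.
  exists (cut_prime S0); split; [exact: cut_prime_prime | exact: cut_prime_edge |].
  exact: cut_prime_height.
move=> P h primeP leP htP; have [S leSP] := prime_over_cut primeP leP.
apply: leq_trans (minS0 S) _; have [[Q chQ] _] := cut_prime_height S.
exact: prime_chain_height chQ primeP leSP htP.
Qed.

Lemma ideal_colon t : is_ideal (fun f => J (t * f)).
Proof.
have [J0 JD JM] := edge_ideal_ideal.
split=> [|f g Jf Jg|a f Jf]; first by rewrite mulr0.
  by rewrite mulrDr; apply: JD.
by rewrite mulrCA; apply: JM.
Qed.

(** The product of the individual multipliers works for all members at once. *)
Lemma common_multiplier P (T : finType) (G : T -> R) : is_prime_ideal P ->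
    (forall k, exists2 t, ~ P t & J (t * G k)) ->
  exists2 t, ~ P t & forall k, J (t * G k).
Proof.
move=> primeP /fin_all_exists2[t Pt JG]; exists (\prod_k t k); first exact: prime_prod.
move=> k; rewrite (bigD1 k) //= mulrAC mulrC.
by have [_ _] := edge_ideal_ideal; apply.
Qed.

Lemma cut_prime_x S i : cut_prime S (x i) -> i \in S.
Proof.
rewrite /cut_prime /param_ker param_x inE vertex_x; case: ifP => // _ /eqP.
by case: ifP; rewrite ?mulf_eq0 !(negPf (xvar_neq0 _ _)).
Qed.

Lemma cut_prime_minor S a b : a \notin S -> b \notin S ->
  ~~ connect (del S) a b -> ~ cut_prime S (minor a b).
Proof.
move=> aS bS nab.
have rab : root (del S) a != root (del S) b by apply: contraNN nab => /del_rootP.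
have col k : k \notin S -> exists2 c, c != 0 &
    param (cut_vars S) (root (del S)) (x k) = c * x (root (del S) k) /\
    param (cut_vars S) (root (del S)) (y k) = c * y (root (del S) k).
  move=> kS; rewrite param_x param_y !inE vertex_x vertex_y (negPf kS).
  case: eqP => [->|_]; first by exists 1; rewrite ?oner_neq0 ?mul1r.
  by exists (x k); rewrite ?xvar_neq0.
have [c c0 [xa ya]] := col a aS; have [d d0 [xb yb]] := col b bS.
rewrite /cut_prime /param_ker rmorphB !rmorphM /= xa ya xb yb.
have -> : forall u v w z : R, c * u * (d * v) - d * w * (c * z) = c * d * (u * v - w * z).
  by move=> u v w z; ring.
by apply/eqP; rewrite !mulf_neq0 ?minor_neq0.
Qed.

(** Each generator of the cut prime is sent into [J] by some multiplier outside
    the prime: the minors by products of first coordinates along a path in the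
    component, the variables at [i] by the minor on [a] and [b].  A common
    multiplier [g] then has [(J : g)] equal to the cut prime. *)
Lemma cut_prime_associated S :
    (forall i, i \in S -> exists a b,
       [/\ e i a, e i b, a \notin S, b \notin S & ~~ connect (del S) a b]) ->
  associated_prime J (cut_prime S).
Proof.
move=> cutS; have primeS := cut_prime_prime S; split=> //.
have [idS S1 SM] := primeS; have [J0 JD JM] := edge_ideal_ideal.
have [t St Jt] : exists2 t, ~ cut_prime S t & forall ij : 'I_n * 'I_n,
    J (t * (if root (del S) ij.1 == root (del S) ij.2 then minor ij.1 ij.2 else 0)).
  apply: common_multiplier => // -[i j] /=.
  case: del_rootP => [|_]; last by exists 1; rewrite ?mulr0.
  elim/connect_ind: i j / => [i|i j k /and3P[eij _ jS] [t St Jt]].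
    by exists 1; rewrite ?minor_ii ?mulr0.
  exists (t * x j); first by move=> /SM[//|/cut_prime_x]; apply/negP.
  rewrite -mulrA minor_x_trans mulrDr; apply: JD; first by rewrite mulrCA; apply: JM.
  by apply/JM/JM/edge_ideal_minor.
have [u Su Ju] : exists2 u, ~ cut_prime S u & forall w,
    J (u * (if w \in cut_vars S then 'X_w else 0)).
  apply: common_multiplier => // w; rewrite inE.
  case: ifP => [|_]; last by exists 1; rewrite ?mulr0.
  move=> /cutS[a [b [eia eib aS bS nab]]]; exists (minor a b); first exact: cut_prime_minor.
  have [Ja Jb] := (edge_ideal_minor eia, edge_ideal_minor eib).
  case: (varP w) eia eib Ja Jb => i; rewrite ?vertex_x ?vertex_y => _ _ Ja Jb.
    have -> : minor a b * x i = x a * minor i b - x b * minor i a.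
      by rewrite /minor; ring.
    by apply: (idealB edge_ideal_ideal); apply: JM.
  have -> : minor a b * y i = y a * minor i b - y b * minor i a.
    by rewrite /minor; ring.
  by apply: (idealB edge_ideal_ideal); apply: JM.
exists (u * t) => f; split=> [Sf|/cut_prime_edge/SM[//|/SM[]//]].
rewrite mulrC; move: f Sf; apply: param_ker_sub; first exact: ideal_colon.
- by move=> i; apply/root_root/del_connect_sym.
- by move=> i j rij; have := JM u _ (Jt (i, j)); rewrite /= rij eqxx mulrA.
- by move=> w wS; have := JM t _ (Ju w); rewrite wS mulrA [t * u]mulrC.
Qed.

(** A vertex of [S] all of whose surviving neighbours lie in one component can
    be put back: this merges no two components of the graph on [~: S] and lowers
    the height. *)
Lemma cut_height_restore S i : i \in S ->
    (forall a b, e i a -> e i b -> a \notin S -> b \notin S -> connect (del S) a b) ->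
  (cut_height (S :\ i) < cut_height S)%N.
Proof.
move=> iS same.
pose kappa w := if w == i then
    if [pick a | e i a && (a \notin S)] is Some a then root (del S) a else i
  else root (del S) w.
have kappa_i v : e i v -> v \notin S -> kappa i = root (del S) v.
  move=> eiv vS; rewrite /kappa eqxx; case: pickP => [a /andP[eia aS]|/(_ v)].
    by apply/eqP/del_rootP/same.
  by rewrite eiv vS.
have kappaE u v : connect (del (S :\ i)) u v -> kappa u = kappa v.
  elim/connect_ind: u v / => // u v w euv <- {w}.
  move: euv; rewrite /del !inE !negb_and !negbK.
  have [->|ui] := eqVneq u i; have [->|vi] := eqVneq v i => // /and3P[euv uS vS].
  - by rewrite (kappa_i v) // /kappa (negPf vi).
  - by rewrite (kappa_i u) ?(e_sym i) // /kappa (negPf ui).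
  - rewrite /kappa (negPf ui) (negPf vi).
    by apply/eqP/del_rootP/connect1/and3P.
pose roots_of T := [set j | root (del T) j == j].
have rootsE T : (#|roots_of T| + #|[set j | root (del T) j != j]| = n)%N.
  rewrite -[RHS](card_ord n) -(cardsC (roots_of T)); congr (_ + _)%N.
  by apply: eq_card => j; rewrite !inE.
(* [kappa] is constant on the components after the restoration, so that distinct
   old components other than [i] itself stay distinct. *)
have le_roots : (#|roots_of S :\ i| <= #|roots_of (S :\ i)|)%N.
  rewrite -(card_in_imset (f := root (del (S :\ i)))); last first.
    move=> r s; rewrite !inE => /andP[ri /eqP fr] /andP[si /eqP fs].
    move=> /eqP/del_rootP/kappaE; rewrite /kappa (negPf ri) (negPf si) fr fs.
    by [].
  apply/subset_leq_card/subsetP => _ /imsetP[r _ ->].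
  by rewrite inE root_root //; apply: del_connect_sym.
have := rootsE S; have := rootsE (S :\ i); have := cardsD1 i (roots_of S).
have := cardsD1 i S; rewrite iS /cut_height; move: le_roots.
move: #|roots_of S :\ i| #|roots_of (S :\ i)| #|roots_of S| #|S :\ i| #|S|.
move: #|[set j | root (del S) j != j]| #|[set j | root (del (S :\ i)) j != j]|.
by case: (i \in roots_of S) => /=; lia.
Qed.

(** The cut prime of the empty set and a cut prime of minimal height are both
    associated primes, so unmixedness equates their heights. *)
Lemma edge_ideal_unmixed_height h :
  unmixed J -> ideal_height J h -> h = cut_height set0.
Proof.
case=> h0 unmix htJ.
have [S0 _ minS0] := @arg_minnP _ (set0 : {set 'I_n}) xpredT cut_height isT.
have {}minS0 S : (cut_height S0 <= cut_height S)%N by apply: minS0.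
have ht0 : cut_height set0 = h0.
  apply: prime_height_uniq (cut_prime_height _) (unmix _ _).
  by apply: cut_prime_associated => i; rewrite inE.
have htS0 : cut_height S0 = h0.
  apply: prime_height_uniq (cut_prime_height _) (unmix _ _).
  apply: cut_prime_associated => i iS; apply: NNPP => nocut.
  have := minS0 (S0 :\ i); rewrite leqNgt => /negP; apply.
  apply: cut_height_restore => // a b eia eib aS bS.
  by apply/contraT => nab; case: nocut; exists a, b.
by rewrite ht0 -htS0; apply: ideal_height_uniq htJ (edge_ideal_height minS0).
Qed.

End CutPrimes.

(** * Path systems *)

Section PathSystems.

Variables (n : nat) (e : rel 'I_n).
Hypotheses (e_sym : symmetric e) (e_irr : irreflexive e).
Local Notation root := fingraph.root.

Implicit Types (H : {set 'I_n}) (p : 'I_n -> 'I_n) (w : 'I_n -> nat).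

(** A family of vertex-disjoint paths covering the graph, read backwards: the
    paths start at [H], [p] is the predecessor of a later vertex, and the weight
    [w], which grows along the paths, excludes cycles. *)
Definition path_system H p w : Prop :=
  (forall v, v \notin H -> e (p v) v /\ (w (p v) < w v)%N) /\
  {in ~: H &, injective p}.

Definition spanning_system H p w : Prop :=
  path_system H p w /\ {in H &, forall a b, connect e a b -> a = b}.

(** Iterated predecessors lose weight, so they end at a head. *)
Lemma path_system_head H p w : path_system H p w ->
  forall v, exists d, [/\ iter d p v \in H, connect e v (iter d p v)
                     & forall j, (j < d)%N -> iter j p v \notin H].
Proof.
case=> pP _ v; move: {2}(w v) (leqnn (w v)) => k; elim: k v => [|k IHk] v le_k.
  have [vH|/pP[_]] := boolP (v \in H); first by exists 0%N.
  by move: le_k; rewrite leqn0 => /eqP ->.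
have [vH|vH] := boolP (v \in H); first by exists 0%N.
have [epv wpv] := pP v vH; have [|d [dH cd ltd]] := IHk (p v).
  by rewrite -ltnS (leq_trans wpv).
exists d.+1; rewrite iterSr; split=> //.
  by apply: connect_trans cd; apply: connect1; rewrite e_sym.
by case=> [|j] // ltj; rewrite iterSr; apply: ltd.
Qed.

(** A component contains a single head, so the vertex farthest from it has every
    other vertex of the component among its iterated predecessors. *)
Lemma spanning_system_traceable H p w : spanning_system H p w -> traceable e.
Proof.
case=> sysP uniqH; have [pP p_inj] := sysP.
have [dep depP] := fin_all_exists (path_system_head sysP).
move=> u0; have [v cv maxv] := arg_maxnP dep (connect0 e u0).
exists v, (traject p (p v) (dep v)).
have step d u : (forall j, (j < d)%N -> iter j p u \notin H) ->
    path (fun a b => e a b && (w b < w a)%N) u (traject p (p u) d).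
  elim: d u => //= d IHd u ltd; have [epu wpu] := pP u (ltd 0%N isT).
  rewrite e_sym epu wpu; apply: IHd => j ltj; rewrite -iterSr.
  exact: ltd j.+1 _.
have [headv cheadv ltv] := depP v; have pathv := step _ _ ltv.
split; first by apply: sub_path pathv => a b /andP[].
  have : sorted (fun a b => (w b < w a)%N) (v :: traject p (p v) (dep v)).
    by apply: sub_path pathv => a b /andP[].
  by apply: sorted_uniq => [a b c ab /leq_trans|a]; [apply; apply: ltnW | rewrite ltnn].
move=> u; rewrite -[v :: _]/(traject p v (dep v).+1); apply/trajectP/idP => [[j ltj ->]|cu].
  apply: connect_trans cv _; elim: j ltj => [|j IHj] ltj; first exact: connect0.
  apply: connect_trans (IHj (ltnW ltj)) _; apply: connect1.
  by rewrite e_sym /=; have [] := pP _ (ltv j ltj).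
have [headu cheadu ltu] := depP u; have le_uv : (dep u <= dep v)%N by apply: maxv.
(* Both trajectories end at the same head and [p] is injective off the heads, so
   they agree from the end backwards. *)
have back k : (k <= dep u)%N -> iter (dep u - k) p u = iter (dep v - k) p v.
  elim: k => [_|k IHk lt_k].
    rewrite !subn0; apply: uniqH => //.
    apply: connect_trans cheadv; apply: connect_trans cv.
    by rewrite (sym_connect_sym e_sym); apply: connect_trans cu cheadu.
  have ltu' : (dep u - k.+1 < dep u)%N by lia.
  have ltv' : (dep v - k.+1 < dep v)%N by lia.
  apply: p_inj; rewrite ?inE ?ltu ?ltv //.
  have := IHk (ltnW lt_k).
  have -> : (dep u - k = (dep u - k.+1).+1)%N by lia.
  by have -> : (dep v - k = (dep v - k.+1).+1)%N by lia.
exists (dep v - dep u)%N; first by rewrite ltnS leq_subr.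
by have := back _ (leqnn _); rewrite subnn.
Qed.

(** Predecessor and weight are read off from the position in the spanning path of
    the component. *)
Lemma traceable_spanning_system : traceable e -> exists H p w, spanning_system H p w.
Proof.
move=> trace; have : forall v, exists q : seq 'I_n,
    [/\ sorted e q, uniq q & q =i connect e v].
  by move=> v; have [u [q [eq uq qE]]] := trace v; exists (u :: q).
case/fin_all_exists => Q QP.
pose L v := Q (root e v); have csym := sym_connect_sym e_sym.
have memL u v : (u \in L v) = connect e v u.
  by have [_ _ ->] := QP (root e v); rewrite unfold_in (same_connect csym (connect_root e v)).
have eqL u v : connect e u v -> L u = L v.
  by move=> cuv; rewrite /L; congr Q; apply/eqP; rewrite root_connect.
have uniqL v : uniq (L v) by have [] := QP (root e v).
have sortL v : sorted e (L v) by have [] := QP (root e v).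
have selfL v : v \in L v by rewrite memL.
pose w v := index v (L v); pose p v := nth v (L v) (w v).-1.
exists [set v | w v == 0%N], p, w.
have ltw v : (w v < size (L v))%N by rewrite index_mem.
have pL v : p v \in L v by rewrite mem_nth // (leq_ltn_trans (leq_pred _)).
have Lp v : L (p v) = L v by apply/esym/eqL; rewrite -memL.
have wp v : w (p v) = (w v).-1.
  by rewrite /w Lp index_uniq // (leq_ltn_trans (leq_pred _)).
have nthL v : nth v (L v) (w v) = v by apply: nth_index.
split; last first.
  move=> a b; rewrite !inE => /eqP wa /eqP wb /eqL eqab.
  by rewrite -[a]nthL -[b]nthL wa wb eqab; apply: set_nth_default; rewrite -wb.
split=> [v|u v].
  rewrite inE wp -lt0n => w0; rewrite prednK //; split=> //.
  by have /(sortedP v)/(_ (w v).-1) := sortL v; rewrite prednK // nthL; apply.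
rewrite !inE -!lt0n => u0 v0 puv.
have eqLuv : L u = L v by rewrite -Lp puv Lp.
have : w u = w v by rewrite -(prednK u0) -(prednK v0) -!wp puv.
move=> wuv; rewrite -[u]nthL -[v]nthL wuv eqLuv.
by apply: set_nth_default; apply: ltw.
Qed.

End PathSystems.

(** * Closed graphs *)

Section ClosedGraphs.

Variables (n : nat) (e : rel 'I_n).
Hypotheses (e_sym : symmetric e) (e_irr : irreflexive e).

Section Monotone.

Variable lt : rel 'I_n.
Hypothesis lt_total : forall a b, a != b -> lt a b || lt b a.
Hypothesis lt_closed : forall a b c,
  lt a b -> lt a c -> e a b -> e a c -> b != c -> e b c.

Definition up : rel 'I_n := fun a b => e a b && lt a b.

(** Prepending an edge to an increasing path: at a local minimum closedness
    supplies a chord, which shortens the path. *)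
Lemma up_extend i j k : e i j -> connect up j k -> connect up i k || connect up k i.
Proof.
move=> eij /connectP[q]; elim: q i j eij => [|j1 q IHq] i j eij /=.
  move=> _ ->; have ij : i != j by apply: contraTneq eij => ->; rewrite e_irr.
  by case/orP: (lt_total ij) => ltij; apply/orP; [left | right];
    apply/connect1/andP; rewrite // e_sym.
case/andP=> /andP[ejj1 ltjj1] pathq lastq.
have ij : i != j by apply: contraTneq eij => ->; rewrite e_irr.
case/orP: (lt_total ij) => ltij.
  apply/orP; left; apply/connectP; exists (j :: j1 :: q) => //=.
  by rewrite /up eij ltij ejj1 ltjj1.
have [-> | ij1] := eqVneq i j1.
  by apply/orP; left; apply/connectP; exists q.
by apply: (IHq i j1) => //; apply: (lt_closed ltij ltjj1); rewrite // e_sym.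
Qed.

End Monotone.

(** In a closed labelling the connected vertices are joined by monotone paths;
    so each vertex is adjacent to the next one of its component, and the
    labels run along a spanning path. *)
Lemma closed_spanning_system :
  closed_graph e -> exists H p w, @spanning_system n e H p w.
Proof.
case=> s closed_s; pose lab v : nat := (s^-1)%g v.
have labK a : s ((s^-1)%g a) = a by apply: permKV.
have lab_inj : injective lab by move=> a b /val_inj /perm_inj.
have neq2 (a b c d : 'I_n) : (a != c) && (a != d) -> [set a; b] != [set c; d].
  move=> /andP[ac ad]; apply: contraNneq ac => E.
  by have := set21 a b; rewrite E !inE (negPf ad) orbF.
have closed_up a b c : (lab a < lab b)%N -> (lab a < lab c)%N ->
    e a b -> e a c -> b != c -> e b c.
  move=> ab ac eab eac bc.
  have := closed_s ((s^-1)%g a) ((s^-1)%g b) ((s^-1)%g a) ((s^-1)%g c).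
  rewrite !labK => /(_ eab eac _ ab ac)[|-> //].
  rewrite [X in X != _]setUC; apply: neq2; rewrite !(inj_eq perm_inj) bc andbT.
  by apply: contraTneq ab => ->; rewrite ltnn.
have closed_down a b c : (lab b < lab a)%N -> (lab c < lab a)%N ->
    e a b -> e a c -> b != c -> e b c.
  move=> ba ca eab eac bc.
  have := closed_s ((s^-1)%g b) ((s^-1)%g a) ((s^-1)%g c) ((s^-1)%g a).
  rewrite !labK ![e _ a]e_sym => /(_ eab eac _ ba ca)[|_ -> //].
  apply: neq2; rewrite !(inj_eq perm_inj) bc /=.
  by apply: contraTneq ba => ->; rewrite ltnn.
have neq_lab a b : a != b -> (lab a < lab b)%N || (lab b < lab a)%N.
  by rewrite -(inj_eq lab_inj) neq_ltn.
pose inc := up (fun a b => lab a < lab b)%N; pose dec := up (fun a b => lab b < lab a)%N.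
have decE a b : connect dec a b = connect inc b a.
  rewrite -[RHS](connect_rev inc); apply: eq_connect => c d.
  by rewrite /dec /inc /up /= e_sym.
have monotone u v : connect e u v -> connect inc u v || connect inc v u.
  elim/connect_ind: u v / => [u|i j k eij]; first by rewrite connect0.
  case/orP=> cjk; first exact: (up_extend neq_lab closed_up eij cjk).
  rewrite -decE in cjk; rewrite -!decE orbC.
  by apply: (up_extend _ closed_down eij cjk) => a b /neq_lab; rewrite orbC.
have inc_lab u v : connect inc u v -> (lab u <= lab v)%N.
  by elim/connect_ind: u v / => // i j k /andP[_ /ltnW]; apply: leq_trans.
have incE : subrel (connect inc) (connect e).
  by apply: connect_sub => b c /andP[ebc _]; apply: connect1.
have predP v : exists u, (exists2 u', connect e u' v & (lab u' < lab v)%N) ->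
    [/\ connect e u v, (lab u < lab v)%N
      & forall u', connect e u' v -> (lab u' < lab v)%N -> (lab u' <= lab u)%N].
  have [/existsP[u0 u0P]|nou] := boolP [exists u, connect e u v && (lab u < lab v)%N].
    pose D u := connect e u v && (lab u < lab v)%N.
    have [u /andP[cu lu] maxu] := @arg_maxnP _ u0 D lab u0P.
    by exists u => _; split=> // u' cu' lu'; apply: maxu; rewrite /D cu'.
  exists v => -[u' cu' lu']; case/negP: nou; apply/existsP.
  by exists u'; rewrite cu'.
have [p pP] := fin_all_exists predP.
pose H := [set v | [forall u, connect e u v ==> (lab v <= lab u)%N]].
have HP v : v \notin H -> exists2 u', connect e u' v & (lab u' < lab v)%N.
  rewrite inE negb_forall => /existsP[u]; rewrite negb_imply -ltnNge => /andP[cu lu].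
  by exists u.
exists H, p, lab; split; last first.
  move=> a b; rewrite !inE => /forallP aH /forallP bH cab; apply: lab_inj.
  apply/eqP; rewrite eqn_leq (implyP (bH a)) // (implyP (aH b)) //.
  by rewrite (sym_connect_sym e_sym).
split=> [v /HP/pP[cv lv maxv]|u v].
  split=> //; case/orP: (monotone _ _ cv) => [/connectP[[|a q] /= pathq lastq]|/inc_lab].
  - by rewrite -lastq ltnn in lv.
  - case/andP: pathq => /andP[epa lpa] pathq.
    have cav : connect inc a v by apply/connectP; exists q.
    have := inc_lab _ _ cav; rewrite leq_eqVlt => /predU1P[/lab_inj av|lav].
      by rewrite av in epa.
    have : (lab a <= lab (p v))%N.
      exact: maxv (incE _ _ cav) lav.
    by rewrite leqNgt lpa.
  - by rewrite leqNgt lv.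
rewrite !in_setC => /HP/pP[cu lu maxu] /HP/pP[cv lv maxv] puv; apply: contraTeq isT => uv.
rewrite puv in cu lu maxu.
have cuv : connect e u v.
  by apply: connect_trans cv; rewrite (sym_connect_sym e_sym).
case/orP: (neq_lab _ _ uv) => lt_lab.
  by have := maxv _ cuv lt_lab; rewrite leqNgt lu.
rewrite (sym_connect_sym e_sym) in cuv.
by have := maxu _ cuv lt_lab; rewrite leqNgt lv.
Qed.

End ClosedGraphs.

(** * Counting heads and components *)

Section Counting.

Variables (n : nat) (e : rel 'I_n).
Hypotheses (e_sym : symmetric e) (e_irr : irreflexive e).
Local Notation root := fingraph.root.
Variables (H : {set 'I_n}) (p : 'I_n -> 'I_n) (w : 'I_n -> nat).
Hypothesis sysP : path_system e H p w.

Lemma card_nonroots S :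
  (#|[set i | root (del e S) i == i]| + #|[set i | root (del e S) i != i]| = n)%N.
Proof.
rewrite -[RHS](card_ord n) -(cardsC [set i | root (del e S) i == i]).
by congr (_ + _)%N; apply: eq_card => j; rewrite !inE.
Qed.

Lemma connect_del0 : connect (del e set0) =2 connect e.
Proof. by apply: eq_connect => i j; rewrite /del !inE !andbT. Qed.

(** The vertex of least weight in a component of the graph on [~: S] is a head,
    belongs to [S], or has its predecessor in [S]; the predecessor map being
    injective, deleting [S] creates few components. *)
Lemma cut_height_lower S : (#|~: H| <= cut_height e S)%N.
Proof.
have [pP p_inj] := sysP.
pose B := (H :|: S) :|: [set v in ~: H | p v \in S].
have csym := del_connect_sym e_sym S.
have sub : [set i | root (del e S) i == i] \subset root (del e S) @: B.
  apply/subsetP => r; rewrite inE => /eqP fr.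
  have [v cv minv] := arg_minnP w (connect0 (del e S) r).
  apply/imsetP; exists v; last by rewrite -fr; apply/eqP; rewrite root_connect.
  rewrite !inE; apply: contraT; rewrite !negb_or negb_and negbK => /andP[/andP[vH vS]].
  rewrite (negPf vH) /= => pS; have [epv wpv] := pP v vH.
  suff: (w v <= w (p v))%N by rewrite leqNgt wpv.
  apply: minv; apply: connect_trans cv _; rewrite csym; apply: connect1.
  by rewrite /del epv pS.
have cardB : (#|B| <= #|H| + #|S| + #|S|)%N.
  apply: leq_trans (leq_card_setU _ _) _; apply: leq_add; first exact: leq_card_setU.
  rewrite -(card_in_imset (f := p)).
    by apply/subset_leq_card/subsetP => u /imsetP[v]; rewrite !inE => /andP[_ pS] ->.
  by move=> a b; rewrite !inE => /andP[aH _] /andP[bH _]; apply: p_inj; rewrite inE.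
have := leq_trans (subset_leq_card sub) (leq_trans (leq_imset_card _ _) cardB).
have := card_nonroots S; have := cardsC H; rewrite card_ord /cut_height.
move: #|[set i | root (del e S) i == i]| #|[set i | root (del e S) i != i]|.
by move: #|H| #|~: H| #|S|; lia.
Qed.

(** With one head in each component there are at most as many heads as
    components. *)
Lemma cut_height0_upper : {in H &, forall a b, connect e a b -> a = b} ->
  (cut_height e set0 <= #|~: H|)%N.
Proof.
move=> uniqH; have csym := del_connect_sym e_sym set0.
have : (#|H| <= #|[set i | root (del e set0) i == i]|)%N.
  rewrite -(card_in_imset (f := root (del e set0)) (D := H)).
    apply/subset_leq_card/subsetP => _ /imsetP[v _ ->].
    by rewrite inE root_root.
  by move=> a b aH bH /eqP; rewrite root_connect // connect_del0; apply: uniqH.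
have := card_nonroots set0; have := cardsC H; rewrite card_ord /cut_height cards0.
move: #|[set i | root (del e set0) i == i]| #|[set i | root (del e set0) i != i]|.
by move: #|H| #|~: H|; lia.
Qed.

(** Every component has a head, so a path system with as few heads as there are
    components is spanning. *)
Lemma path_system_spanning : #|~: H| = cut_height e set0 -> spanning_system e H p w.
Proof.
move=> cardH; split=> // a b aH bH cab.
have csym := del_connect_sym e_sym set0.
have sub : [set i | root (del e set0) i == i] \subset root (del e set0) @: H.
  apply/subsetP => r; rewrite inE => /eqP fr.
  have [d [dH cd _]] := path_system_head e_sym sysP r.
  apply/imsetP; exists (iter d p r) => //; rewrite -{1}fr; apply/eqP.
  by rewrite root_connect // connect_del0.
have /imset_injP inj : #|root (del e set0) @: H| == #|H|.
  rewrite eqn_leq leq_imset_card /=; apply: leq_trans (subset_leq_card sub).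
  have := card_nonroots set0; have := cardsC H; rewrite card_ord.
  move: cardH; rewrite /cut_height cards0.
  move: #|[set i | root (del e set0) i == i]| #|[set i | root (del e set0) i != i]|.
  by move: #|H| #|~: H|; lia.
by apply: inj => //; apply/eqP; rewrite root_connect // connect_del0.
Qed.

End Counting.

(** * Monomial orders and regular sequences of monomials *)

Section Monomials.

Variables (N : nat) (K : fieldType).
Local Notation R := {mpoly K[N]}.

Section LeadMonomial.

Variable le : rel 'X_{1..N}.
Hypothesis le_order : monomial_order le.

Lemma lead_monomP (f : R) : f != 0 ->
  lead_monom le f \in msupp f /\ {in msupp f, forall m, le m (lead_monom le f)}.
Proof.
have [tot anti trans le0 _] := le_order; have refl m : le m m by have := tot m m; rewrite orbb.
rewrite -msupp_eq0 /lead_monom; elim: (msupp f) => // m s IHs _.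
rewrite big_cons; have [->|s0] := eqVneq s [::].
  rewrite big_nil; case: ifP => [lem|_]; last by split=> [|m']; rewrite inE // => /eqP ->.
  have -> : m = 0%MM by apply: anti; rewrite lem le0.
  by split=> [|m']; rewrite inE // => /eqP ->.
have [Bs leB] := IHs s0; case: ifP => [leB'|/negbT nle].
  by split=> [|m']; rewrite inE ?Bs ?orbT // => /predU1P[->|/leB].
set B := \big[_/_]_(_ <- _) _ in Bs leB nle *.
have leBm : le B m by have := tot m B; rewrite (negPf nle).
split=> [|m']; rewrite inE ?eqxx // => /predU1P[->|/leB lem'] //.
exact: trans lem' leBm.
Qed.

Lemma lead_monom_eq (f : R) m :
  m \in msupp f -> {in msupp f, forall m', le m' m} -> lead_monom le f = m.
Proof.
move=> mf maxm; have f0 : f != 0 by rewrite -msupp_eq0; case: (msupp f) mf.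
have [lf maxl] := lead_monomP f0; have [_ anti _ _ _] := le_order.
by apply: anti; rewrite maxl // maxm.
Qed.

End LeadMonomial.

Lemma monomial_idealP (ms : seq 'X_{1..N}) (f : R) :
  ideal_of_seq [seq 'X_[m] | m <- ms] f <->
  {in msupp f, forall u, exists2 m, m \in ms & (m <= u)%MM}.
Proof.
have idI := ideal_gen_ideal (fun g : R => g \in [seq 'X_[m] | m <- ms]).
split=> [[k [a [g [gS ->]]]] u|supf].
  rewrite mcoeff_msupp => u0; apply: NNPP => nom; case/eqP: u0.
  rewrite raddf_sum big1 //= => i _; apply/eqP; rewrite mcoeff_eq0.
  have /mapP[m mS ->] := gS i; apply/negP; rewrite (perm_mem (msuppMX _ _)).
  by case/mapP=> m' _ uE; apply: nom; exists m; rewrite // uE lem_addr.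
rewrite [f]mpolyE big_seq; apply: ideal_sum => // u /supf[m mS le_mu].
rewrite -(submK le_mu) mpolyXD -mul_mpolyC mulrA; case: (idI) => _ _; apply.
by apply: ideal_gen_mem; apply: map_f.
Qed.

Definition coprime_monomials (m m' : 'X_{1..N}) : bool :=
  [forall i, (m i == 0%N) || (m' i == 0%N)].

(** A divisor of [g v] that is coprime to [v] divides [g]. *)
Lemma monomial_regular (ms : seq 'X_{1..N}) :
    pairwise coprime_monomials ms -> 0%MM \notin ms ->
  regular_sequence [seq 'X_[K, m] | m <- ms].
Proof.
move=> /(pairwiseP 0%MM) copr nz; split=> [k g|].
  rewrite size_map => ltk; rewrite (nth_map 0%MM) // -map_take.
  move/monomial_idealP => supg; apply/monomial_idealP => u ug.
  have [|m /(nthP 0%MM)[j]] := supg (nth 0%MM ms k + u)%MM.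
    by rewrite (perm_mem (msuppMX _ _)); apply: map_f.
  rewrite size_take ltk => ltj; rewrite nth_take // => <- /mnm_lepP le_ju.
  exists (nth 0%MM ms j); first by rewrite -(nth_take _ ltj) mem_nth // size_take ltk.
  apply/mnm_lepP => i; have := le_ju i; rewrite mnmDE.
  have /forallP/(_ i) := copr j k (ltn_trans ltj ltk) ltk ltj.
  by case/orP => /eqP ->; rewrite ?add0n.
move/monomial_idealP => /(_ 0%MM); rewrite msupp1 mem_head => -[] // m mS.
move/mnm_lepP => m0; case/negP: nz; suff <- : m = 0%MM by [].
by apply/mnmP => i; have := m0 i; rewrite mnm0E leqn0 => /eqP.
Qed.

End Monomials.

(** * Coprime initial forms from spanning paths *)

Section SpanningSystemKonig.

Variables (n : nat) (K : fieldType) (e : rel 'I_n).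
Hypotheses (e_sym : symmetric e) (e_irr : irreflexive e).
Local Notation R := {mpoly K[n + n]}.
Local Notation x := (xvar K).
Local Notation y := (yvar K).
Local Notation minor := (minor K).
Local Notation J := (binomial_edge_ideal K e).

Section WeightOrder.

Variable w : 'I_n -> nat.

Definition y_weight (m : 'X_{1..n + n}) : nat := (\sum_i m (rshift n i) * w i)%N.

(** Comparing the [w]-weighted [y]-degrees first makes [x_i y_j] the leading
    monomial of the minor on [i, j] whenever [w i < w j]. *)
Definition weight_le : rel 'X_{1..n + n} := fun m m' =>
  (y_weight m < y_weight m')%N || (y_weight m == y_weight m') && (m <= m')%O.

Lemma y_weightD m m' : y_weight (m + m')%MM = (y_weight m + y_weight m')%N.
Proof.
by rewrite -big_split; apply: eq_bigr => i _; rewrite mnmDE mulnDl.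
Qed.

Lemma y_weight_xy i j : y_weight (U_(lshift n i) + U_(rshift n j))%MM = w j.
Proof.
rewrite y_weightD /y_weight big1 ?add0n => [|k _]; last by rewrite mnm1E eq_lrshift.
rewrite (bigD1 j) //= mnm1E eqxx mul1n big1 ?addn0 // => k kj.
by rewrite mnm1E eq_rshift eq_sym (negPf kj).
Qed.

Lemma weight_le_order : monomial_order weight_le.
Proof.
rewrite /weight_le; split=> [m m'|m m'|m2 m1 m3|m|m m1 m2].
- by case: ltngtP => //= _; apply: Order.TotalTheory.le_total.
- by case: ltngtP => //= _; apply: Order.POrderTheory.le_anti.
- case: ltngtP => //= [lt12 _|->]; last first.
    by case: ltngtP => //= _; apply: Order.POrderTheory.le_trans.
  by case: ltngtP => //= [lt23 _|<- _]; rewrite ?lt12 // (ltn_trans lt12 lt23).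
- have -> : y_weight 0%MM = 0%N by rewrite /y_weight big1 // => i _; rewrite mnm0E.
  by case: ltngtP => //= _; apply: le0m.
- by rewrite !y_weightD ltn_add2r eqn_add2r lemc_add2l.
Qed.

Lemma initial_minor i j : (w i < w j)%N ->
  initial weight_le (minor i j) = 'X_[U_(lshift n i) + U_(rshift n j)].
Proof.
move=> ltij; have ij : i != j by apply: contraTneq ltij => ->; rewrite ltnn.
rewrite /initial (negPf (minor_neq0 K ij)); congr 'X_[_].
apply: (lead_monom_eq weight_le_order).
  rewrite mcoeff_msupp minor_coef eqxx eq_mnm_xy (negPf ij) subr0.
  exact: oner_neq0.
move=> m; rewrite mcoeff_msupp minor_coef.
have [-> _|_] := eqVneq m (U_(lshift n i) + U_(rshift n j))%MM.
  by rewrite /weight_le eqxx Order.POrderTheory.lexx orbT.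
have [-> _|_] := eqVneq m (U_(lshift n j) + U_(rshift n i))%MM; last first.
  by rewrite subrr eqxx.
by rewrite /weight_le !y_weight_xy ltij.
Qed.

End WeightOrder.

Lemma minor_homog (i j : 'I_n) : minor i j \is 2.-homog.
Proof.
by apply: rpredB; rewrite -mpolyXD dhomogX /= mdegD !mdeg1.
Qed.

(** Setting all variables outside one edge to zero annihilates the minors of the
    other edges but not its own, so no generator is superfluous. *)
Lemma edge_minors_minimal (E : seq ('I_n * 'I_n)) :
    uniq E ->
    (forall i j, (i, j) \in E -> e i j /\ (j, i) \notin E) ->
    (forall i j, e i j -> (i, j) \in E \/ (j, i) \in E) ->
  minimal_generators J [seq minor q.1 q.2 | q <- E].
Proof.
move=> uniqE E_edge edgeE; split.
- by move=> _ /mapP[q _ ->]; exists 2%N; apply: minor_homog.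
- move=> f; split; move: f.
    apply: ideal_gen_min; first exact: edge_ideal_ideal.
    by move=> _ /mapP[[i j] /E_edge[eij _] ->]; apply: edge_ideal_minor.
  have idI := ideal_gen_ideal (fun g => g \in [seq minor q.1 q.2 | q <- E]).
  apply: edge_ideal_min => // i j /edgeE[ijE|jiE].
    by apply: ideal_gen_mem; apply/mapP; exists (i, j).
  rewrite minorC; apply: (idealN idI); apply: ideal_gen_mem.
  by apply/mapP; exists (j, i).
move=> _ /subseqP[b szb ->] genJ; rewrite -map_mask; congr map.
set E' := mask b E; have subE' : subseq E' E by apply: mask_subseq; rewrite -szb size_map.
apply/eqP; rewrite -(size_subseq_leqif subE') eqn_leq size_subseq //=.
apply: uniq_leq_size => // -[i j] ijE; apply: contraT => ijE'.
have [eij jiE] := E_edge i j ijE.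
have ij : i != j by apply: contraTneq eij => ->; rewrite e_irr.
pose A : {set 'I_(n + n)} := [set w | vertex w \in [set i; j]].
have rA k l : retract A (minor k l) =
    if (k \in [set i; j]) && (l \in [set i; j]) then minor k l else 0.
  rewrite rmorphB !rmorphM /= !retractX !(inE, vertex_x, vertex_y).
  by case: (_ || _); case: (_ || _); rewrite ?mul0r ?mulr0 ?subrr.
suff : retract A (minor i j) = 0.
  by rewrite rA !inE !eqxx orbT => /eqP; rewrite (negPf (minor_neq0 K ij)).
have := edge_ideal_minor K e_sym e_irr eij; move/genJ; rewrite -map_mask.
have idA : is_ideal (fun f : R => retract A f = 0) by have [] := prime_ker (@retract _ K A).
move: (minor i j); apply: ideal_gen_min; first exact: idA.
move=> _ /mapP[[k l] klE' ->]; rewrite rA /=; case: ifP => //.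
have klE := mem_subseq subE' klE'; have [ekl _] := E_edge k l klE.
rewrite !inE => /andP[/orP[]/eqP kE /orP[]/eqP lE]; move: klE klE' ekl; rewrite kE lE.
- by rewrite e_irr.
- by rewrite (negPf ijE').
- by rewrite (negPf jiE).
- by rewrite e_irr.
Qed.

(** The minors on the path edges are completed by the minors on the other edges
    to a minimal system of generators. *)
Lemma spanning_system_konig H p w : spanning_system e H p w -> konig_type J.
Proof.
case=> sysP uniqH; have [pP p_inj] := sysP.
have ht0 : cut_height e set0 = #|~: H|.
  by apply/eqP; rewrite eqn_leq (cut_height0_upper e_sym uniqH) (cut_height_lower e_sym sysP).
exists #|~: H|; split.
  rewrite -ht0; apply: edge_ideal_height => // S.
  by rewrite ht0 (cut_height_lower e_sym sysP).
pose F := [seq (p v, v) | v <- enum (~: H)].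
pose G := [seq q : 'I_n * 'I_n <- enum {: 'I_n * 'I_n} |
            [&& (q.1 < q.2)%N, e q.1 q.2, q \notin F & (q.2, q.1) \notin F]].
have FP i j : ((i, j) \in F) = (j \notin H) && (i == p j).
  apply/mapP/andP => [[v]|[jH /eqP ->]].
    by rewrite mem_enum inE => vH [-> ->].
  by exists j; rewrite ?mem_enum ?inE.
have GP i j : ((i, j) \in G) = [&& (i < j)%N, e i j, (i, j) \notin F & (j, i) \notin F].
  by rewrite mem_filter mem_enum andbT.
exists [seq minor (p v) v | v <- enum (~: H)]; split.
- by rewrite size_map -cardE.
- exists [seq minor q.1 q.2 | q <- G].
  have -> : [seq minor (p v) v | v <- enum (~: H)] = [seq minor q.1 q.2 | q <- F].
    by rewrite -map_comp.
  rewrite -map_cat; apply: edge_minors_minimal.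
  + rewrite cat_uniq filter_uniq ?enum_uniq // andbT map_inj_uniq ?enum_uniq => [|a b [] //].
    by apply/hasPn => -[i j]; rewrite GP => /and4P[].
  + move=> i j; rewrite !mem_cat !GP => /orP[ijF|/and4P[ltij eij ijF jiF]]; last first.
      by rewrite (negPf jiF) [(j < i)%N]ltnNge (ltnW ltij).
    rewrite ijF !andbF orbF; move: ijF; rewrite !FP => /andP[jH /eqP ->].
    have [ej wj] := pP j jH; split=> //; apply/negP => /andP[/pP[_ lt_w] /eqP jE].
    by move: lt_w; rewrite -jE ltnNge (ltnW wj).
  move=> i j eij; rewrite !mem_cat !GP eij e_sym eij /=.
  have [ijF|ijF] := boolP ((i, j) \in F); first by left.
  have [jiF|jiF] := boolP ((j, i) \in F); first by right.
  have [lt_ij|lt_ji|/val_inj E] := ltngtP i j; [by left | by right |].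
  by rewrite E e_irr in eij.
exists (weight_le w); first exact: weight_le_order.
have -> : [seq initial (weight_le w) i | i <- [seq minor (p v) v | v <- enum (~: H)]]
    = [seq 'X_[m] | m <- [seq (U_(lshift n (p v)) + U_(rshift n v))%MM
                          | v <- enum (~: H)]].
  rewrite -!map_comp; apply/eq_in_map => v; rewrite mem_enum inE => /pP[_ lt_w].
  exact: initial_minor.
apply: monomial_regular; last first.
  by apply/mapP => -[v _ /eqP]; rewrite eq_sym mnmD_eq0 mnm1_eq0.
rewrite pairwise_map; have := enum_uniq (~: H); rewrite uniq_pairwise.
apply: (sub_in_pairwise (P := [in ~: H])) => [u v uH vH /= uv|]; last first.
  by apply/allP => v; rewrite mem_enum.
have puv : p u != p v by apply: contraNneq uv => /p_inj ->.
apply/forallP => z; case: (varP z) => i.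
  rewrite !mnmDE !mnm1E !eq_rlshift !eq_lshift !addn0.
  have [<-|//] := eqVneq (p u) i.
  by rewrite [p v == _]eq_sym (negPf puv).
rewrite !mnmDE !mnm1E !eq_lrshift !eq_rshift !add0n.
have [<-|//] := eqVneq u i.
by rewrite [v == _]eq_sym (negPf uv).
Qed.

End SpanningSystemKonig.

(** * From a regular sequence of initial forms to spanning paths *)

Section KonigSpanningSystem.

Section LowDegree.

Variables (N : nat) (K : fieldType).
Local Notation R := {mpoly K[N]}.

Definition order_ge2 (f : R) := forall m, (mdeg m < 2)%N -> f@_m = 0.

Lemma mcoeffMXU (f : R) i m :
  ('X_i * f)@_m = if m i == 0%N then 0 else f@_(m - U_(i)).
Proof.
rewrite mulrC; case: ifPn => [mi|]; last first.
  by rewrite -lep1mP => /submK {1}<-; rewrite addmC mcoeffMX.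
apply/eqP; rewrite mcoeff_eq0 (perm_mem (msuppMX _ _)).
by apply/mapP => -[u _ mE]; move: mi; rewrite mE mnmDE mnm1E eqxx.
Qed.

(** Only the constant term of [a] reaches the quadratic part of [a f]. *)
Lemma order_ge2_mul (a f : R) : order_ge2 f ->
  order_ge2 (a * f) /\ forall m, mdeg m = 2%N -> (a * f)@_m = a@_0%MM * f@_m.
Proof.
move: f; elim/mpoly_ind_ring: a => [c|i|a b IHa IHb|a b IHa IHb] f lowf.
- split=> [m /lowf|m _]; rewrite mcoeffCM; first by move=> ->; rewrite mulr0.
  by rewrite mcoeffC eqxx mulr1.
- have X0 m : (mdeg m < 3)%N -> ('X_i * f)@_m = 0.
    move=> ltm; rewrite mcoeffMXU; case: ifPn => // mi; apply: lowf.
    rewrite -lep1mP in mi; have := mdegD (m - U_(i)) U_(i).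
    by rewrite (submK mi) mdeg1; lia.
  split=> [m ltm|m degm]; first by rewrite X0 // ltnW.
  by rewrite X0 ?degm // mcoeffX mnm1_eq0 mul0r.
- have [lowa Ea] := IHa f lowf; have [lowb Eb] := IHb f lowf; split=> m degm.
    by rewrite mulrDl mcoeffD lowa // lowb // addr0.
  by rewrite mulrDl !mcoeffD Ea // Eb // mulrDl.
have [lowb Eb] := IHb f lowf; have [lowab Eab] := IHa _ lowb.
rewrite -mulrA; split=> // m degm; rewrite Eab // Eb // mulrA.
by rewrite -[RHS]/(mcoeff 0%MM (a * b) * _) rmorphM.
Qed.

Lemma homog2_order_ge2 (f : R) : f \is 2.-homog -> order_ge2 f.
Proof.
move=> homf m ltm; apply: dhomog_nemf_coeff homf _.
by rewrite -[X in X != _]/(mdeg m) neq_ltn ltm.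
Qed.

(** In an ideal generated in degree 2 the quadrics are linear combinations of the
    quadrics of any homogeneous generating sequence, so a minimal one contains
    nothing else. *)
Lemma minimal_generators_quadrics (S : R -> Prop) s :
    (forall f, S f -> f \is 2.-homog) -> minimal_generators (ideal_gen S) s ->
  forall f, f \in s -> f \is 2.-homog.
Proof.
move=> homS [homs genS mins]; pose quadric (f : R) := f \is 2.-homog.
have lowS f : ideal_gen S f -> order_ge2 f.
  move=> [k [a [g [Sg ->]]]] m ltm; rewrite raddf_sum big1 // => i _ /=.
  by have [-> //] := order_ge2_mul (a i) (homog2_order_ge2 (homS _ (Sg i))).
suff <- : filter quadric s = s by move=> f; rewrite mem_filter => /andP[].
have idq := ideal_gen_ideal (fun g => g \in filter quadric s).
apply: mins => [|f]; first exact: filter_subseq.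
split=> [qf|]; last first.
  move: f; apply: ideal_gen_min => // f Sf; have homf := homS f Sf.
  have /genS[k [a [g [gs fE]]]] := ideal_gen_mem Sf.
  have -> : f = \sum_(i | quadric (g i)) ((a i)@_0%MM)%:MP * g i.
    apply/mpolyP => m; rewrite raddf_sum /=.
    have [degm|degm] := eqVneq (mdeg m) 2%N; last first.
      rewrite (dhomog_nemf_coeff homf degm) big1 // => i homg.
      by rewrite mcoeffCM (dhomog_nemf_coeff homg degm) mulr0.
    rewrite fE raddf_sum [RHS]big_mkcond /=; apply: eq_bigr => i _.
    have lowg : order_ge2 (g i) by apply/lowS/genS/ideal_gen_mem.
    have [_ -> //] := order_ge2_mul (a i) lowg; rewrite mcoeffCM.
    case: ifPn => // nhom; have [d homd] := homs _ (gs i).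
    rewrite (dhomog_nemf_coeff homd) ?mulr0 //.
    by rewrite -[X in X != _]/(mdeg m) degm; apply: contraNneq nhom => E; rewrite /quadric E.
  apply: ideal_sum => // i homg; case: (idq) => _ _; apply.
  by apply: ideal_gen_mem; rewrite mem_filter gs andbT.
apply/genS; move: f qf; apply: ideal_gen_min; first exact: ideal_gen_ideal.
by move=> f; rewrite mem_filter => /andP[_ fs]; apply: ideal_gen_mem.
Qed.

(** If [z] divided both [u = z u'] and a later [v = z v'], then
    [u' v = u v'] would force the linear form [u'] into a quadric ideal. *)
Lemma regular_quadrics_coprime (ms : seq 'X_{1..N}) :
    regular_sequence [seq 'X_[K, m] | m <- ms] ->
    {in ms, forall m, mdeg m = 2%N} ->
  pairwise (@coprime_monomials N) ms.
Proof.
case=> regms _ degms; apply/(pairwiseP 0%MM) => j k ltj ltk ltjk.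
rewrite !inE in ltj ltk.
apply: contraT; rewrite negb_forall => /existsP[i]; rewrite negb_or -!lep1mP.
case/andP=> le_j le_k; set mj := nth 0%MM ms j in le_j; set mk := nth 0%MM ms k in le_k.
have jT : mj \in take k ms.
  by rewrite /mj -(nth_take _ ltjk) mem_nth // size_take ltk.
have : ideal_of_seq [seq 'X_[K, m] | m <- take k ms] 'X_[mj - U_(i)].
  have := regms k 'X_[mj - U_(i)]; rewrite size_map (nth_map 0%MM) // -map_take.
  apply=> //; rewrite -/mk -(submK le_k) mpolyXD mulrCA -mpolyXD (submK le_j).
  have [_ _] := ideal_gen_ideal (fun g : R => g \in [seq 'X_[m] | m <- take k ms]).
  by apply; apply: ideal_gen_mem; apply: map_f.
move/monomial_idealP => /(_ (mj - U_(i))%MM); rewrite msuppX mem_head => -[] // m mT le_m.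
have degm : mdeg m = 2%N by apply: degms; apply: mem_take mT.
have degj : mdeg mj = 2%N by apply: degms; apply: mem_nth.
have := congr1 (@mdeg N) (submK le_j); have := congr1 (@mdeg N) (submK le_m).
by rewrite !mdegD degm degj mdeg1; lia.
Qed.

End LowDegree.

Section System.

Variables (n : nat) (K : fieldType) (e : rel 'I_n).
Hypotheses (e_sym : symmetric e) (e_irr : irreflexive e).
Local Notation R := {mpoly K[n + n]}.
Local Notation minor := (minor K).
Local Notation J := (binomial_edge_ideal K e).
Local Notation xy i j := (U_(lshift n i) + U_(rshift n j))%MM.

(** The quadratic part of an element of [J] is a linear combination of edge
    minors, whose coefficients and monomials have these two properties. *)
Lemma edge_ideal_quadric (f : R) : J f ->
  (forall a b, f@_(xy a b) = - f@_(xy b a)) /\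
  (forall m, mdeg m = 2%N -> f@_m != 0 -> exists a b, e a b /\ m = xy a b).
Proof.
move=> [k [a [g [gE fE]]]].
have coefE m : mdeg m = 2%N -> f@_m = \sum_i (a i)@_0%MM * (g i)@_m.
  move=> degm; rewrite fE raddf_sum; apply: eq_bigr => i _ /=.
  have [u [v [_ _ gi]]] := gE i.
  have lowg : order_ge2 (g i) by rewrite gi; apply/homog2_order_ge2/minor_homog.
  by have [_ ->] := order_ge2_mul (a i) lowg.
have deg_xy u v : mdeg (xy u v) = 2%N by rewrite mdegD !mdeg1.
split=> [u v|m degm].
  rewrite !coefE // -sumrN; apply: eq_bigr => i _; rewrite -mulrN; congr (_ * _).
  have [i1 [i2 [_ _ ->]]] := gE i; rewrite -/(minor i1 i2) !minor_coef !eq_mnm_xy.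
  by rewrite opprB ![(v == _) && _]andbC.
rewrite coefE // => nz; apply: NNPP => nom; case/eqP: nz.
apply: big1 => i _; have [i1 [i2 [_ ei ->]]] := gE i.
rewrite -/(minor i1 i2) minor_coef.
have [mE|_] := eqVneq m (xy i1 i2); first by case: nom; exists i1, i2.
have [mE|_] := eqVneq m (xy i2 i1); first by case: nom; exists i2, i1; rewrite e_sym.
by rewrite subrr mulr0.
Qed.

Section Ratio.

Variable le : rel 'X_{1..n + n}.
Hypothesis le_order : monomial_order le.

(** The order compares the ratios [x_u / y_u]. *)
Definition ratio_gt (u v : 'I_n) : bool := ~~ le (xy u v) (xy v u).

Lemma ratio_gt_trans v u z : ratio_gt u v -> ratio_gt v z -> ratio_gt u z.
Proof.
have [tot anti trans _ le_add] := le_order.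
move=> uv vz; apply/negP => le_uz.
have le_vu : le (xy v u) (xy u v) by have := tot (xy v u) (xy u v); rewrite (negPf uv) orbF.
have le_zv : le (xy z v) (xy v z) by have := tot (xy z v) (xy v z); rewrite (negPf vz) orbF.
have le1 := le_add (xy v v) _ _ le_uz; have le2 := le_add (xy v u) _ _ le_zv.
have le3 := le_add (xy v z) _ _ le_vu.
have E1 : (xy u z + xy v v = xy u v + xy v z)%MM by apply/mnmP => i; rewrite !mnmDE; lia.
have E2 : (xy z u + xy v v = xy z v + xy v u)%MM by apply/mnmP => i; rewrite !mnmDE; lia.
have E3 : (xy v z + xy v u = xy v u + xy v z)%MM by apply/mnmP => i; rewrite !mnmDE; lia.
rewrite E1 E2 in le1; rewrite E3 in le2.
have E : (xy u v + xy v z = xy v u + xy v z)%MM.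
  by apply: anti; rewrite le3 (trans _ _ _ le1 le2).
by case/negP: uv; rewrite (addIm E); have := tot (xy v u) (xy v u); rewrite orbb.
Qed.

(** Counting the vertices with a larger ratio gives a weight that grows from a
    predecessor to its successor. *)
Definition ratio_rank v := #|[set u | ratio_gt u v]|.

Lemma ratio_rank_lt u v : ratio_gt u v -> (ratio_rank u < ratio_rank v)%N.
Proof.
move=> uv; apply: proper_card; apply/properP; split.
  by apply/subsetP => z; rewrite !inE => zu; apply: ratio_gt_trans zu uv.
have [tot _ _ _ _] := le_order.
exists u; rewrite !inE // negbK.
by have := tot (xy u u) (xy u u); rewrite orbb.
Qed.

End Ratio.

(** The initial monomial [x_a y_b] of a member of the sequence makes [a] the
    predecessor of [b]; vertices that are no such [b] are the heads. *)
Lemma konig_path_system :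
    konig_type J -> unmixed J ->
  exists H p w, path_system e H p w /\ #|~: H| = cut_height e set0.
Proof.
case=> h [htJ [fs [sz_fs [gs minJ] [le le_order reg]]]] unmix.
have [tot anti trans _ le_add] := le_order.
have hE := edge_ideal_unmixed_height e_sym e_irr unmix htJ.
have homfs f : f \in fs -> f \is 2.-homog.
  move=> ffs; apply: minimal_generators_quadrics minJ _ _; last by rewrite mem_cat ffs.
  by move=> g [i [j [_ _ ->]]]; apply: minor_homog.
have Jfs f : f \in fs -> J f.
  by move=> ffs; case: minJ => _ genJ _; apply/genJ/ideal_gen_mem; rewrite mem_cat ffs.
have nz f : f \in fs -> f != 0.
  move=> ffs; apply: contraT; rewrite negbK => /eqP f0; case: reg => reg1 not1.
  have ltk : (index f fs < size (map (initial le) fs))%N by rewrite size_map index_mem.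
  case: not1; apply: (ideal_gen_min _ _ (reg1 _ 1 ltk _)); first exact: ideal_gen_ideal.
    by move=> g /mem_take gs'; apply: ideal_gen_mem.
  rewrite mul1r (nth_map 0) ?index_mem // nth_index // /initial f0 eqxx.
  by have [] := ideal_gen_ideal (fun g : R => g \in take (index 0 fs) (map (initial le) fs)).
have ms_map : map (initial le) fs = [seq 'X_[m] | m <- map (lead_monom le) fs].
  rewrite -map_comp; apply/eq_in_map => f /nz f0 /=.
  by rewrite /initial (negPf f0).
have leadP f : f \in fs -> exists ab : 'I_n * 'I_n,
    [/\ e ab.1 ab.2, lead_monom le f = xy ab.1 ab.2 & ratio_gt le ab.1 ab.2].
  move=> ffs; have [lf maxl] := lead_monomP le_order (nz f ffs).
  have degl : mdeg (lead_monom le f) = 2%N by have /dhomogP/(_ _ lf) := homfs f ffs.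
  have [anti_f suppf] := edge_ideal_quadric (Jfs f ffs).
  have [|a [b [eab lE]]] := suppf _ degl; first by rewrite -mcoeff_msupp.
  exists (a, b); split=> //=; have ab : a != b by apply: contraTneq eab => ->; rewrite e_irr.
  have le_ba : le (xy b a) (xy a b).
    rewrite -lE; apply: maxl; rewrite mcoeff_msupp anti_f -lE oppr_eq0.
    by rewrite -mcoeff_msupp.
  apply/negP => le_ab; case/negP: ab.
  have : xy a b = xy b a by apply: anti; rewrite le_ab.
  by move/eqP; rewrite eq_mnm_xy => /andP[].
have fsk (k : 'I_h) : fs`_k \in fs by rewrite mem_nth // sz_fs.
have [ab abP] := fin_all_exists (fun k => leadP _ (fsk k)).
have copr : pairwise (@coprime_monomials _) (map (lead_monom le) fs).
  apply: (regular_quadrics_coprime (K := K)); first by rewrite -ms_map.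
  move=> _ /mapP[f /leadP[c [_ -> _]] ->].
  by rewrite mdegD !mdeg1.
have coprk (j k : 'I_h) : (j < k)%N ->
    coprime_monomials (xy (ab j).1 (ab j).2) (xy (ab k).1 (ab k).2).
  move=> ltjk; have [_ <- _] := abP j; have [_ <- _] := abP k.
  have := (pairwiseP 0%MM copr) j k; rewrite !inE size_map sz_fs.
  by move=> /(_ (ltn_ord j) (ltn_ord k) ltjk); rewrite !(nth_map 0) ?sz_fs.
have ab_inj (j k : 'I_h) : ((ab j).1 == (ab k).1) || ((ab j).2 == (ab k).2) -> j = k.
  wlog ltjk : j k / (j < k)%N => [wlog_jk|]; last first.
    have /forallP copjk := coprk j k ltjk.
    case/orP => /eqP E; [have := copjk (lshift n (ab j).1) | have := copjk (rshift n (ab j).2)].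
      by rewrite !mnmDE !mnm1E E eqxx !eq_rlshift.
    by rewrite !mnmDE !mnm1E E eqxx !eq_lrshift.
  have [ltjk|ltkj|/val_inj //] := ltngtP j k; first exact: wlog_jk.
  by rewrite [(ab j).1 == _]eq_sym [(ab j).2 == _]eq_sym => /wlog_jk ->.
pose H := ~: [set (ab k).2 | k : 'I_h].
pose p v := if [pick k | (ab k).2 == v] is Some k then (ab k).1 else v.
have pP v : v \notin H -> exists2 k, v = (ab k).2 & p v = (ab k).1.
  rewrite !inE negbK => /imsetP[k _ vE]; exists k => //; rewrite /p.
  case: pickP => [j /eqP jv|/(_ k)]; last by rewrite vE eqxx.
  by rewrite (ab_inj j k) // jv vE eqxx orbT.
exists H, p, (ratio_rank le); split; last first.
  rewrite setCK card_imset ?card_ord // => j k E; apply: ab_inj.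
  by rewrite E eqxx orbT.
split=> [v /pP[k -> ->]|u v].
  by have [eab _ gt_ab] := abP k; split=> //; apply: ratio_rank_lt.
have inH z : z \in ~: H -> z \notin H by rewrite in_setC.
move=> /inH/pP[j -> ->] /inH/pP[k -> ->] E.
by rewrite (ab_inj j k) // E eqxx.
Qed.

Lemma konig_unmixed_traceable : konig_type J -> unmixed J -> traceable e.
Proof.
move=> konJ /(konig_path_system konJ)[H [p [w [sysP cardH]]]].
apply: (spanning_system_traceable e_sym (H := H) (p := p) (w := w)).
exact: path_system_spanning.
Qed.

End System.
End KonigSpanningSystem.

Theorem proposition3p6 (K : fieldType) (n : nat) (e : rel 'I_n)
    (e_sym : symmetric e) (e_irr : irreflexive e) :
  ((traceable e -> konig_type (binomial_edge_ideal K e)) /\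
   (closed_graph e -> konig_type (binomial_edge_ideal K e))) /\
  (unmixed (binomial_edge_ideal K e) -> konig_type (binomial_edge_ideal K e) ->
   traceable e).
Proof.
split=> [|unmix kon]; last exact: konig_unmixed_traceable kon unmix.
split.
  move=> /(traceable_spanning_system e_sym)[H [p [w sysP]]].
  exact: spanning_system_konig sysP.
move=> /(closed_spanning_system e_sym e_irr)[H [p [w sysP]]].
exact: spanning_system_konig sysP.
Qed.
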